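(* Let $n\ge1$, let $\{X^u\}_{u\in\mathbb{N}^n}$ be a one-critical, exhaustive $n$-parameter filtration of a cell complex $X$, let $\mathcal{V}$ be a discrete gradient vector field on $X$ consistent with the filtration, and let $\{M^u\}_{u\in\mathbb{N}^n}$ be the associated $n$-parameter filtration of the Morse complex $M$. Let $\xi_i^q$ be the Betti tables of $V_q=\bigoplus_{u\in\mathbb{N}^n}H_q(X^u)$. Then the following hold. (1) Let $q\in\mathbb{N}$. If $u\in\mathbb{N}^n$ satisfies $B_q(M^u)=\sum_{j=1}^nB_q(M^{u-e_j})$ and there exists a permutation $\rho$ of $[n]$ such that, for every $\ell\in[n]$, $$Z_q(M^{u-e_{\rho(\ell)}})\cap\Big(\sum_{j<\ell}Z_q(M^{u-e_{\rho(j)}})\Big)=\sum_{j<\ell}Z_q(M^{u-e_{\rho(j)}-e_{\rho(\ell)}}),$$ then $\xi_1^q(u)=0$. As a consequence, $\operatorname{supp}\xi_1^q\subseteq\mathcal{G}(M_{q+1})\cup\overline{\mathcal{G}(M_q)}$. (2) In the case $q=0$, if $u\in\mathbb{N}^n$ is such that $B_0(M^u)=\sum_{j=1}^nB_0(M^{u-e_j})$, then $\xi_1^0(u)=0$. As a consequence, $$\operatorname{supp}\xi_0^0\subseteq\overline{\mathcal{G}(M_0)},\qquad\operatorname{supp}\xi_1^0\subseteq\mathcal{G}(M_1),\qquad\bigcup_{i=1}^n\operatorname{supp}\xi_i^0\subseteq\overline{\mathcal{G}(M_1)}.$$ (3) In the case $n=2$, for $q\in\mathbb{N}$, if $u\in\mathbb{N}^2$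 is such that $B_q(M^u)=B_q(M^{u-e_1})+B_q(M^{u-e_2})$, then $\xi_1^q(u)=0$. Moreover $$\operatorname{supp}\xi_0^q\subseteq\overline{\mathcal{G}(M_q)},\qquad\operatorname{supp}\xi_1^q\subseteq\mathcal{G}(M_{q+1}),\qquad\operatorname{supp}\xi_2^q\subseteq\overline{\mathcal{G}(M_{q+1})}.$$
   Context: $\mathbb{F}$ is a fixed field, $\mathbb{N}=\{0,1,\dots\}$, $[n]=\{1,\dots,n\}$, $e_1,\dots,e_n$ is the standard basis of $\mathbb{N}^n$, and $\preceq$ is the coordinatewise order on $\mathbb{N}^n$, with least upper bound $\bigvee$. A cell complex is a finite graded set $X=\bigsqcup_{q\in\mathbb{N}}X_q$ (elements of $X_q$ are $q$-cells) with an incidence function $\kappa:X\times X\to\mathbb{F}$ such that $\kappa(\tau,\sigma)\neq0$ implies $\dim\tau=\dim\sigma+1$, and $\sum_{\rho\in X}\kappa(\tau,\rho)\kappa(\rho,\sigma)=0$ for all $\tau,\sigma$. Write $\sigma<\tau$ if $\kappa(\tau,\sigma)\ne0$; the face partial order $\le$ on $X$ is generated by this relation. $C_*(X)$ is the chain complex with $C_q(X)$ the $\mathbb{F}$-vector space with basis $X_q$ and $\partial_q(\tau)=\sum_{\sigma\in X_{q-1}}\kappa(\tau,\sigma)\sigma$ (with $C_q=0$ for $q<0$). A subcomplex is a subset closed under passing to faces, with the restricted incidence function. $H_q$ denotes homology. An $n$-parameter filtration of $X$ is a family of subcomplexes $\{X^u\}_{u\in\mathbb{N}^n}$ with $X^u\subseteq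 X^v$ for $u\preceq v$; one sets $X^w=\emptyset$ if $w\notin\mathbb{N}^n$. It is exhaustive if $X=\bigcup_uX^u$. A grade $u$ is an entrance grade of a cell $\sigma$ if $\sigma\in X^u\setminus\bigcup_{j=1}^nX^{u-e_j}$. The filtration is one-critical if $X^u=\{\sigma\in X\mid h(\sigma)\preceq u\}$ for some order-preserving $h:(X,\le)\to(\mathbb{N}^n,\preceq)$ (equivalently, every cell has exactly one entrance grade). $S=\mathbb{F}[x_1,\dots,x_n]$; $V_q$ is an $n$-graded $S$-module, with $x_i$ acting by the maps $H_q(X^u)\to H_q(X^{u+e_i})$ induced by inclusion. $\xi_i^q(u)=\dim_{\mathbb{F}}(\operatorname{Tor}_i^S(V_q,\mathbb{F}))^u$, where $\mathbb{F}=S/\langle x_1,\dots,x_n\rangle$; $\operatorname{supp}\xi_i^q=\{u\mid\xi_i^q(u)\neq0\}$. A discrete vector field $\mathcal{V}$ on $X$ is a set of pairs $(\sigma,\tau)\in X\times X$ with $\sigma<\tau$ such that every cell appears in at most one pair (in at most one position). It is a discrete gradient vector field if there is no sequence $(\sigma_0,\tau_0,\dots,\sigma_{r-1},\tau_{r-1},\sigma_r)$ with $r\ge1$, $(\sigma_i,\tau_i)\in\mathcal{V}$, $\sigma_{i+1}<\tau_i$, $\sigma_{i+1}\ne\sigma_i$ for all $0\le i<r$, and $\sigma_r=\sigma_0$. It is consistent with the filtration if for all $(\sigma,\tau)\in\mathcal{V}$ and all $u$, $\sigma\in X^u$ if and only if $\tau\in X^u$. The Morse complex $M=\bigsqcup_qM_q$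 is the set of critical cells (cells in no pair of $\mathcal{V}$), graded by dimension, with the standard incidence function of discrete Morse theory: for $\tau\in M_{q}$, $\sigma\in M_{q-1}$, $$\kappa^M(\tau,\sigma)=\kappa(\tau,\sigma)+\sum\kappa(\tau,\sigma_0)\prod_{i=0}^{r-1}\Big(-\frac{\kappa(\tau_i,\sigma_{i+1})}{\kappa(\tau_i,\sigma_i)}\Big),$$ the sum being over all sequences $(\sigma_0,\tau_0,\dots,\sigma_{r-1},\tau_{r-1},\sigma_r)$ with $r\ge1$, $\sigma_0<\tau$, $(\sigma_i,\tau_i)\in\mathcal{V}$, $\sigma_{i+1}<\tau_i$, $\sigma_{i+1}\neq\sigma_i$, and $\sigma_r=\sigma$. With $M^u=M\cap X^u$ (and $M^w=\emptyset$ for $w\notin\mathbb{N}^n$), consistency of $\mathcal{V}$ implies that $\{M^u\}$ is a filtration of $M$ by subcomplexes. $Z_q(M^v)=\ker(\partial^M_q|_{C_q(M^v)})$ and $B_q(M^v)=\partial^M_{q+1}(C_{q+1}(M^v))$ are the cycles and boundaries of $C_*(M^v)$, as subspaces of $C_q(M)$; empty sums are $0$. $\mathcal{G}(M_q)\subseteq\mathbb{N}^n$ is the set of entrance grades of the critical $q$-cells, and for $G\subseteq\mathbb{N}^n$, $\overline{G}=\{\bigvee L\mid L\subseteq G\text{ finite}, L\ne\emptyset\}$. *)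

(* Defs.v *)
From HB Require Import structures.
From mathcomp Require Import all_boot all_order all_fingroup all_algebra.

Set Implicit Arguments.
Unset Strict Implicit.
Unset Printing Implicit Defensive.

Import GRing.Theory.
Local Open Scope ring_scope.

Definition grade (n : nat) := {ffun 'I_n -> nat}.

Definition gle n (u v : grade n) : bool := [forall i, (u i <= v i)%N].
Definition gadd n (u v : grade n) : grade n := [ffun i => (u i + v i)%N].
(* Truncated: only meaningful when [gle v u]. *)
Definition gsub n (u v : grade n) : grade n := [ffun i => (u i - v i)%N].
Definition gunit n (j : 'I_n) : grade n := [ffun i => nat_of_bool (i == j)].
Definition gsup n (L : seq (grade n)) : grade n :=
  [ffun i => \max_(v <- L) v i].

(* The closure of G under joins of finite nonempty subsets. *)
Definition join_closure n (G : grade n -> Prop) (u : grade n) : Prop :=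
  exists L : seq (grade n),
    [/\ L != [::], (forall v, v \in L -> G v) & u = gsup L].

(* A^(u - a), with the convention A^w = set0 when w = u - a is not in N^n. *)
Definition at_sub n (T : finType) (A : grade n -> {set T}) (u a : grade n) :
  {set T} := if gle a u then A (gsub u a) else set0.

Lemma gleP n (u v : grade n) : reflect (forall i, u i <= v i)%N (gle u v).
Proof. exact: forallP. Qed.

Lemma gle_refl n (u : grade n) : gle u u.
Proof. exact/gleP. Qed.

Lemma gle_trans n (v u w : grade n) : gle u v -> gle v w -> gle u w.
Proof. by move=> /gleP a /gleP b; apply/gleP => i; exact: leq_trans (b i). Qed.

(* The finite list of all v with v <= u. *)
Definition gbelow n (u : grade n) : seq (grade n) :=
  [seq v : grade n <- [seq [ffun i => val (f i)]
    | f : {ffun 'I_n -> 'I_(\max_i u i).+1}] | gle v u].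

Lemma mem_gbelow n (u v : grade n) : (v \in gbelow u) = gle v u.
Proof.
rewrite mem_filter; case: (boolP (gle v u)) => //= /gleP vu.
apply/imageP; exists [ffun i => inord (v i)] => //.
apply/ffunP => i; rewrite !ffunE inordK // ltnS.
exact: leq_trans (vu i) (leq_bigmax i).
Qed.

(* Quotient vector spaces: Z / (Z :&: B) is realised on a complement of
   Z :&: B in Z; [qproj Z B] restricted to Z is the canonical projection. *)

Section Quotient.
Variables (F : fieldType) (vT : vectType F).
Implicit Types Z B : {vspace vT}.

Definition qspace Z B : vectType F := subvs_of (Z :\: B)%VS.

Definition qproj Z B : 'Hom(vT, qspace Z B) :=
  (linfun (vsproj (Z :\: B)%VS) \o addv_pi1 Z B)%VF.

Definition qrepr Z B : 'Hom(qspace Z B, vT) := linfun vsval.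

Lemma val_qproj Z B x : vsval (qproj Z B x) = addv_pi1 Z B x.
Proof. by rewrite comp_lfunE lfunE /= vsprojK //; apply: memv_pi. Qed.

Lemma qreprE Z B (x : qspace Z B) : qrepr Z B x = vsval x.
Proof. exact: lfunE. Qed.

Lemma qrepr_in Z B (x : qspace Z B) : qrepr Z B x \in Z.
Proof. by rewrite qreprE; apply: (subvP (diffvSl Z B)); apply: subvsP. Qed.

Lemma qreprK Z B : cancel (qrepr Z B) (qproj Z B).
Proof.
move=> x; apply: (can_inj (@vsvalK _ _ _)); rewrite val_qproj qreprE.
by rewrite daddv_pi_id ?capv_diff ?subvsP.
Qed.

Lemma qproj_eq0 Z B x : x \in Z -> (qproj Z B x == 0) = (x \in B).
Proof.
move=> xZ; rewrite -(inj_eq val_inj) /= val_qproj.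
have xZB : x \in (Z + B)%VS by rewrite (subvP (addvSl Z B)).
have /= e := addv_pi1_pi2 xZB; apply/eqP/idP => [p0|xB].
  by move: e; rewrite p0 add0r => <-; apply: memv_pi2.
by move: e; rewrite addv_pi2_id // => /(canRL (addrK _)) ->; rewrite subrr.
Qed.

Lemma qproj_repr_sub Z B x : x \in Z -> qrepr Z B (qproj Z B x) - x \in B.
Proof.
move=> xZ; rewrite qreprE val_qproj.
have xZB : x \in (Z + B)%VS by rewrite (subvP (addvSl Z B)).
by rewrite -{2}(addv_pi1_pi2 xZB) opprD addNKr rpredN memv_pi2.
Qed.

End Quotient.

(* An N^n-graded module V over S = F[x_1, ..., x_n] (finite dimensional in
   each grade), given by its homogeneous components and, for u <= v, the
   multiplication by the monomial x^(v - u), as a map V^u -> V^v; in particular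
   x_j acts by [gmul V u (gadd u (gunit j))]. The value of [gmul] when u is not
   below v is irrelevant. *)
Record gmodule (n : nat) (F : fieldType) := GModule {
  gcomp :> grade n -> vectType F;
  gmul : forall u v, 'Hom(gcomp u, gcomp v);
  gmul_id : forall u x, gmul u u x = x;
  gmul_comp : forall u v w x, gle u v -> gle v w ->
    gmul v w (gmul u v x) = gmul u w x
}.

(* The free module with g v generators in degree v, that is, the direct sum of
   the S(-v)^(g v). The generators are the pairs (v, k) with k < g v, and a
   basis of its component in grade u is given by the elements x^(u - v) (v, k)
   with v <= u. *)

Section Free.
Variables (n : nat) (F : fieldType) (g : grade n -> nat).

Definition fgens (u : grade n) : seq (grade n * nat) :=
  [seq (v, k) | v <- gbelow u, k <- iota 0 (g v)].

Lemma mem_fgens u p : (p \in fgens u) = gle p.1 u && (p.2 < g p.1)%N.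
Proof.
apply/allpairsPdep/andP => [[v [k [vu kg ->]]]|[pu pg]].
  by move: vu kg; rewrite mem_gbelow mem_iota.
by exists p.1, p.2; rewrite mem_gbelow mem_iota -surjective_pairing.
Qed.

Definition free_comp (u : grade n) : vectType F :=
  {ffun seq_sub (fgens u) -> F^o}.

Definition free_mul_fun u w (f : free_comp u) : free_comp w :=
  [ffun q => \sum_(p | ssval p == ssval q) f p].

Fact free_mul_linear u w : linear (@free_mul_fun u w).
Proof.
move=> a f h; apply/ffunP => q; rewrite !ffunE scaler_sumr -big_split.
by apply: eq_bigr => p _; rewrite !ffunE.
Qed.
HB.instance Definition _ u w :=
  GRing.isLinear.Build F (free_comp u) (free_comp w) *:%R (@free_mul_fun u w)
    (@free_mul_linear u w).

Definition free_mul u w : 'Hom(free_comp u, free_comp w) :=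
  linfun (@free_mul_fun u w).

Lemma free_mulE u w f q :
  free_mul u w f q = \sum_(p | ssval p == ssval q) f p.
Proof. by rewrite lfunE ffunE. Qed.

Fact free_mul_id u x : free_mul u u x = x.
Proof.
by apply/ffunP => q; rewrite free_mulE (big_pred1 q).
Qed.

(* Any generator living in grade u lives in every grade above u. *)
Lemma fgens_widen u v (p : seq_sub (fgens u)) : gle u v -> ssval p \in fgens v.
Proof.
move=> uv; case: p => p /=; rewrite !mem_fgens => /andP[pu ->].
by rewrite (gle_trans pu uv).
Qed.

Lemma free_sum_widen (V : lmodType F) u v (f : free_comp u)
    (G : grade n * nat -> V) : gle u v ->
  \sum_q (free_mul u v f q) *: G (ssval q) = \sum_p f p *: G (ssval p).
Proof.
move=> uv; under eq_bigr do rewrite free_mulE scaler_suml big_mkcond /=.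
rewrite exchange_big /=; apply: eq_bigr => p _.
by rewrite -big_mkcond (big_pred1 (SeqSub (fgens_widen p uv))) //=.
Qed.

Fact free_mul_comp u v w x : gle u v -> gle v w ->
  free_mul v w (free_mul u v x) = free_mul u w x.
Proof.
move=> uv vw; apply/ffunP => q; rewrite !free_mulE.
have e t (y : free_comp t) : \sum_(p | ssval p == ssval q) y p =
    \sum_p y p *: ((ssval p == ssval q)%:R : F^o).
  rewrite big_mkcond; apply: eq_bigr => p _.
  by case: eqP => _; rewrite ?scaler0 // [_ *: _]mulr1.
by rewrite !e (free_sum_widen x (fun r => (r == ssval q)%:R : F^o) uv).
Qed.

Definition free_module : gmodule n F := GModule free_mul_id free_mul_comp.

End Free.

(* The free module on a homogeneous F-basis of V, the surjection
   [cover_map] : cover V -> V, and its kernel [syz V]. *)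

Section Cover.
Variables (n : nat) (F : fieldType) (V : gmodule n F).

Definition cover : gmodule n F := free_module F (fun v => \dim {:V v}).

Definition cover_fun u (f : cover u) : V u :=
  \sum_p f p *:
    gmul V (ssval p).1 u (vbasis {:V (ssval p).1})`_(ssval p).2.

Fact cover_linear u : linear (@cover_fun u).
Proof.
move=> a f h; rewrite /cover_fun scaler_sumr -big_split.
by apply: eq_bigr => p _; rewrite !ffunE scalerDl scalerA.
Qed.
HB.instance Definition _ u :=
  GRing.isLinear.Build F (cover u) (V u) *:%R (@cover_fun u) (@cover_linear u).

Definition cover_map u : 'Hom(cover u, V u) := linfun (@cover_fun u).

Lemma cover_mapE u f : cover_map u f = cover_fun f.
Proof. by rewrite lfunE. Qed.

Lemma cover_map_natural u w f : gle u w ->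
  cover_map w (gmul cover u w f) = gmul V u w (cover_map u f).
Proof.
move=> uw; rewrite !cover_mapE /cover_fun linear_sum.
rewrite (free_sum_widen f
  (fun r => gmul V r.1 w (vbasis {:V r.1})`_(r.2)) uw).
apply: eq_bigr => -[p pu] _ /=; rewrite linearZ /= gmul_comp //.
by move: pu; rewrite mem_fgens => /andP[].
Qed.

Lemma cover_map_surj u : limg (cover_map u) = fullv.
Proof.
apply/eqP; rewrite eqEsubv subvf /=; apply/subvP => x _.
rewrite (coord_vbasis (memvf x)); apply: memv_suml => i _; apply: memvZ.
have pu : (u, nat_of_ord i) \in fgens (fun v => \dim {:V v}) u.
  by rewrite mem_fgens gle_refl ltn_ord.
apply/memv_imgP.
exists ([ffun p => (p == SeqSub pu)%:R] : cover u); rewrite ?memvf //.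
rewrite cover_mapE /cover_fun (bigD1 (SeqSub pu)) //= ffunE eqxx scale1r.
rewrite gmul_id big1 ?addr0 // => p /negPf np.
by rewrite ffunE np scale0r.
Qed.

Definition syz_comp u : vectType F := subvs_of (lker (cover_map u)).

Definition syz_mul u w : 'Hom(syz_comp u, syz_comp w) :=
  (linfun (vsproj (lker (cover_map w))) \o gmul cover u w \o linfun vsval)%VF.

Lemma val_syz_mul u w x : gle u w ->
  vsval (syz_mul u w x) = gmul cover u w (vsval x).
Proof.
move=> uw; rewrite !comp_lfunE (lfunE vsval) (lfunE (vsproj _)).
apply: vsprojK; rewrite memv_ker cover_map_natural //.
by have := subvsP x; rewrite memv_ker => /eqP ->; rewrite linear0.
Qed.

Fact syz_mul_id u x : syz_mul u u x = x.
Proof. by apply: val_inj; rewrite /= val_syz_mul ?gle_refl // gmul_id. Qed.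

Fact syz_mul_comp u v w x : gle u v -> gle v w ->
  syz_mul v w (syz_mul u v x) = syz_mul u w x.
Proof.
move=> uv vw; apply: val_inj; rewrite /= !val_syz_mul ?(gle_trans uv vw) //.
by rewrite gmul_comp.
Qed.

Definition syz : gmodule n F := GModule syz_mul_id syz_mul_comp.

Definition syz_incl u : 'Hom(syz u, cover u) := linfun vsval.

End Cover.

(* Tor^S(V, F), as the homology of P (x)_S F, where ... -> P 1 -> P 0 -> V is
   the standard graded free resolution of V obtained by iterating [cover] and
   [syz]. *)

Section Tor.
Variables (n : nat) (F : fieldType).

Definition res (V : gmodule n F) (i : nat) : gmodule n F :=
  cover (iter i (@syz n F) V).

Definition res_diff (V : gmodule n F) i u : 'Hom(res V i.+1 u, res V i u) :=
  (syz_incl (iter i (@syz n F) V) u \o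
   cover_map (syz (iter i (@syz n F) V)) u)%VF.

Lemma res_diff_natural V i u w x : gle u w ->
  res_diff V i w (gmul (res V i.+1) u w x) =
  gmul (res V i) u w (res_diff V i u x).
Proof.
move=> uw; rewrite !comp_lfunE cover_map_natural //.
by rewrite !(lfunE vsval) /= val_syz_mul.
Qed.

Lemma res_exact0 V u : limg (res_diff V 0 u) = lker (cover_map V u).
Proof.
rewrite limg_comp cover_map_surj; apply/vspaceP => x; apply/memv_imgP/idP.
  by case=> y _ ->; rewrite lfunE; apply: subvsP.
by move=> xk; exists (Subvs xk); rewrite ?memvf // lfunE.
Qed.

Lemma res_exact V i u : limg (res_diff V i.+1 u) = lker (res_diff V i u).
Proof.
have -> : lker (res_diff V i u) =
    lker (cover_map (syz (iter i (@syz n F) V)) u).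
  apply/vspaceP => x; rewrite !memv_ker comp_lfunE.
  by rewrite /syz_incl (lfunE vsval) -(inj_eq val_inj).
exact: (res_exact0 (syz (iter i (@syz n F) V)) u).
Qed.

(* The component in grade u of P (x)_S S/<x_1, ..., x_n> = P / <x_1, ..., x_n>P,
   and the map that a morphism d : P -> Q of graded modules induces on it. *)
Definition maxideal_mul (P : gmodule n F) (u : grade n) : {vspace P u} :=
  (\sum_(j < n | gle (gunit j) u) limg (gmul P (gsub u (gunit j)) u))%VS.

Definition tensF (P : gmodule n F) (u : grade n) : vectType F :=
  qspace fullv (maxideal_mul P u).

Definition tensF_map (P Q : gmodule n F) u (d : 'Hom(P u, Q u)) :
  'Hom(tensF P u, tensF Q u) :=
  (qproj fullv (maxideal_mul Q u) \o d \o qrepr fullv (maxideal_mul P u))%VF.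

Definition tor_cycles (V : gmodule n F) (i : nat) (u : grade n) :
  {vspace tensF (res V i) u} :=
  match i with
  | 0 => fullv
  | i'.+1 => lker (tensF_map (res_diff V i' u))
  end.

Definition tor_boundaries (V : gmodule n F) (i : nat) (u : grade n) :
  {vspace tensF (res V i) u} := limg (tensF_map (res_diff V i u)).

Definition Tor (V : gmodule n F) (i : nat) (u : grade n) : vectType F :=
  qspace (tor_cycles V i u) (tor_boundaries V i u).

Definition betti (V : gmodule n F) (i : nat) (u : grade n) : nat :=
  \dim {: Tor V i u}.

End Tor.

Record gradedCells (F : fieldType) := GradedCells {
  cell :> finType;
  cdim : cell -> nat;
  kappa : cell -> cell -> F
}.

Record cellComplex (F : fieldType) := CellComplex {
  cells :> gradedCells F;
  kappa_dim : forall t s : cells,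
    kappa t s != 0 -> cdim t = (cdim s).+1;
  kappa_kappa : forall t s : cells, \sum_r kappa t r * kappa r s = 0
}.

(* The relation s < t generating the face order, and the face order. *)
Definition facet F (K : gradedCells F) (s t : K) : bool := kappa t s != 0.
Definition face_le F (K : gradedCells F) (s t : K) : bool :=
  connect (@facet F K) s t.

Definition is_subcomplex F (K : gradedCells F) (A : {set K}) : Prop :=
  forall s t : K, face_le s t -> t \in A -> s \in A.

(* Chains, as elements of the total chain space spanned by all the cells; the
   chain groups C_q(A) are subspaces of it. *)

Section Chains.
Variables (F : fieldType) (K : gradedCells F).

Definition chain : vectType F := {ffun K -> F^o}.

Definition cell_chain (s : K) : chain := [ffun t => (t == s)%:R].

Definition boundary_fun (c : chain) : chain :=
  [ffun s => \sum_t (c t : F) * kappa t s].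

Fact boundary_linear : linear boundary_fun.
Proof.
move=> a c d; apply/ffunP => s; rewrite !ffunE scaler_sumr -big_split.
by apply: eq_bigr => t _; rewrite !ffunE mulrDl scalerAl.
Qed.
HB.instance Definition _ :=
  GRing.isLinear.Build F chain chain *:%R boundary_fun boundary_linear.

Definition boundary : 'End(chain) := linfun boundary_fun.

Lemma boundary_cell (t : K) :
  boundary (cell_chain t) = \sum_s kappa t s *: cell_chain s.
Proof.
apply/ffunP => s; rewrite lfunE ffunE sum_ffunE (bigD1 t) //= big1 => [|r rt].
  rewrite addr0 ffunE eqxx mul1r (bigD1 s) //= big1 => [|r rs].
    by rewrite !ffunE eqxx addr0 [_ *: _]mulr1.
  by rewrite !ffunE eq_sym (negPf rs) scaler0.
by rewrite ffunE (negPf rt) mul0r.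
Qed.

Definition Cq (q : nat) (A : {set K}) : {vspace chain} :=
  <<[seq cell_chain s | s <- enum A & cdim s == q]>>%VS.
Definition Zq (q : nat) (A : {set K}) : {vspace chain} :=
  (Cq q A :&: lker boundary)%VS.
Definition Bq (q : nat) (A : {set K}) : {vspace chain} :=
  (boundary @: Cq q.+1 A)%VS.

Lemma CqS q (A A' : {set K}) : A \subset A' -> (Cq q A <= Cq q A')%VS.
Proof.
move=> /subsetP AA'; apply: sub_span => _ /mapP[s + ->].
rewrite mem_filter mem_enum => /andP[sq sA]; apply: map_f.
by rewrite mem_filter mem_enum sq AA'.
Qed.

Lemma ZqS q (A A' : {set K}) : A \subset A' -> (Zq q A <= Zq q A')%VS.
Proof. by move=> AA'; apply: capvS; rewrite ?CqS. Qed.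

Lemma BqS q (A A' : {set K}) : A \subset A' -> (Bq q A <= Bq q A')%VS.
Proof. by move=> AA'; apply/limgS/CqS. Qed.

End Chains.

(* The module whose component in grade u is H_q(A u), where the monomials act
   by the maps induced by inclusions. *)

Section HomologyModule.
Variables (n : nat) (F : fieldType) (K : gradedCells F) (q : nat).
Variables (A : grade n -> {set K}).
Hypothesis A_mono : forall u v, gle u v -> A u \subset A v.

Definition hom_comp u : vectType F := qspace (Zq q (A u)) (Bq q (A u)).

Definition hom_mul u v : 'Hom(hom_comp u, hom_comp v) :=
  (qproj (Zq q (A v)) (Bq q (A v)) \o qrepr (Zq q (A u)) (Bq q (A u)))%VF.

Lemma hom_mulE u v x : hom_mul u v x = qproj _ _ (qrepr _ _ x).
Proof. exact: comp_lfunE. Qed.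

Fact hom_mul_id u x : hom_mul u u x = x.
Proof. by rewrite hom_mulE qreprK. Qed.

Fact hom_mul_comp u v w x : gle u v -> gle v w ->
  hom_mul v w (hom_mul u v x) = hom_mul u w x.
Proof.
move=> uv vw; rewrite !hom_mulE; set z := qrepr _ _ x.
have zv : z \in Zq q (A v) by apply: subvP (ZqS q (A_mono uv)) _ (qrepr_in x).
apply/eqP; rewrite -subr_eq0 -linearB /=; set y := _ - z.
have yB : y \in Bq q (A v) by exact: qproj_repr_sub.
have yZ : y \in Zq q (A v) by rewrite rpredB // qrepr_in.
by rewrite (qproj_eq0 _ (subvP (ZqS q (A_mono vw)) _ yZ))
  (subvP (BqS q (A_mono vw)) _ yB).
Qed.

Definition homology_module : gmodule n F := GModule hom_mul_id hom_mul_comp.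

End HomologyModule.

Record filtration (n : nat) (F : fieldType) (X : cellComplex F) := Filtration {
  fam :> grade n -> {set X};
  fam_subcomplex : forall u, is_subcomplex (fam u);
  fam_mono : forall u v, gle u v -> fam u \subset fam v
}.

Section Filtrations.
Variables (n : nat) (F : fieldType) (X : cellComplex F) (Xf : filtration n X).

Definition exhaustive : Prop := forall s : X, exists u, s \in Xf u.

Definition one_critical : Prop :=
  exists h : X -> grade n,
    (forall s t : X, face_le s t -> gle (h s) (h t)) /\
    (forall u, Xf u = [set s | gle (h s) u]).

Definition entrance_grade (s : X) (u : grade n) : Prop :=
  s \in Xf u /\ forall j : 'I_n, s \notin at_sub Xf u (gunit j).

Definition Vmod (q : nat) : gmodule n F :=
  homology_module q (@fam_mono _ _ _ Xf).

Definition xi (q i : nat) (u : grade n) : nat := betti (Vmod q) i u.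

Definition supp_xi (q i : nat) (u : grade n) : Prop := xi q i u <> 0%N.

End Filtrations.

Section Morse.
Variables (F : fieldType) (X : cellComplex F) (V : {set X * X}).

Definition discrete_vector_field : Prop :=
  (forall p, p \in V -> facet p.1 p.2) /\
  (forall p p', p \in V -> p' \in V ->
    [/\ p.1 = p'.1 -> p = p', p.2 = p'.2 -> p = p' & p.1 <> p'.2]).

(* A sequence (s_0, t_0, ..., s_(r-1), t_(r-1), s_r) is encoded by the list p of
   the pairs (s_i, t_i) for i < r, and by its last term e = s_r. As e is the
   default value in [path_s], [path_s p e (size p)] is indeed e. *)
Definition path_s (p : seq (X * X)) (e : X) (i : nat) : X :=
  nth e (unzip1 p) i.
Definition path_t (p : seq (X * X)) (e : X) (i : nat) : X :=
  nth e (unzip2 p) i.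

Definition gradient_path (p : seq (X * X)) (e : X) : bool :=
  [&& (0 < size p)%N, all (mem V) p &
      [forall i : 'I_(size p),
        facet (path_s p e i.+1) (path_t p e i) &&
        (path_s p e i.+1 != path_s p e i)]].

Definition discrete_gradient_vector_field : Prop :=
  discrete_vector_field /\
  forall p e, gradient_path p e -> path_s p e 0 <> e.

Definition critical (c : X) : bool :=
  [forall p in V, (c != p.1) && (c != p.2)].

(* If V is a gradient field, the cells s_0, ..., s_(r-1) of a path are
   distinct, so that the sum over the paths with r <= #|X| below is the sum over
   all the paths. *)
Definition kappa_morse (t s : X) : F :=
  if cdim t == (cdim s).+1 then
    kappa t s +
    \sum_(p : {bseq #|X| of X * X} |
          gradient_path p s && facet (path_s p s 0) t)
      kappa t (path_s p s 0) *
      \prod_(i < size p)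
        - (kappa (path_t p s i) (path_s p s i.+1) /
           kappa (path_t p s i) (path_s p s i))
  else 0.

Definition morse : gradedCells F :=
  @GradedCells F {c : X | critical c} (fun c => cdim (val c))
    (fun t s => kappa_morse (val t) (val s)).

Section MorseFiltration.
Variables (n : nat) (Xf : filtration n X).

Definition consistent : Prop :=
  forall p u, p \in V -> (p.1 \in Xf u <-> p.2 \in Xf u).

Definition morse_fam (u : grade n) : {set morse} :=
  [set c | val c \in Xf u].

(* Z_q(M^(u - a)) and B_q(M^(u - a)), as subspaces of the chains of M. *)
Definition Zsub (q : nat) (u a : grade n) : {vspace chain morse} :=
  Zq q (at_sub morse_fam u a).
Definition Bsub (q : nat) (u a : grade n) : {vspace chain morse} :=
  Bq q (at_sub morse_fam u a).

(* The set G(M_q). *)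
Definition morse_grades (q : nat) (u : grade n) : Prop :=
  exists c : X, [/\ critical c, cdim c = q & entrance_grade Xf c u].

End MorseFiltration.
End Morse.

(* Main.v *)
From HB Require Import structures.
Require Import Defs.
From mathcomp Require Import all_boot all_order all_fingroup all_algebra.

(* Discrete Morse theory identifies H_q(X^u), naturally in u, with the homology
   of M^u, so V_q = Z/B for the graded submodules Z and B of cycles and
   boundaries of C_q(M). Vanishing of Tor_i(V_q, F) in grade u follows from
   exactness in degree i of the Koszul complex of V_q in grade u (dimension
   shifting along the syzygies, using that free modules are Koszul acyclic in
   positive degrees), which in turn follows from exactness for Z in degree i
   and for B in degree i - 1. For i = 1, exactness for B is the hypothesis
   B_q(M^u) = sum_j B_q(M^(u - e_j)), and the condition on the permutation
   allows one to write a Koszul 1-cycle of Z as a boundary, one direction at a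
   time. If u is not a join of grades of q-cells, then in some direction j no
   q-cell below u reaches the j-th coordinate of u, and inserting j contracts
   the Koszul complex of every submodule of C_q(M) cut out by a condition
   independent of the grade, such as Z. *)

Set Implicit Arguments.
Unset Strict Implicit.
Unset Printing Implicit Defensive.

Import GRing.Theory.
Local Open Scope ring_scope.

Lemma gle_gadd n (u a v : grade n) :
  gle a u -> gle v (gsub u a) = gle (gadd v a) u.
Proof.
move=> /gleP au; apply/gleP/gleP => h i; move: (h i);
  by rewrite !ffunE leq_subRL ?au // addnC.
Qed.

(** * Koszul differential and contraction on families in a single space *)

Section KoszulFamilies.
Variables (F : fieldType) (n : nat).
Implicit Types (A B : {set 'I_n}) (j k l : 'I_n).

Definition eset A : grade n := [ffun i => nat_of_bool (i \in A)].

(** The sign of the exterior product of e_k and e_A: to reach its place, e_k passes the elements of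
    [A] below [k]. *)
Definition ksign k A : F := (-1) ^+ #|[set a in A | (a < k)%N]|.

Lemma ksignU1 k l A : l \notin A ->
  ksign k (l |: A) = ksign k A * (-1) ^+ (l < k)%N.
Proof.
move=> lA; rewrite /ksign -exprD; congr (_ ^+ _); rewrite addnC.
case: (ltnP l k) => lk.
  have -> : [set a in l |: A | (a < k)%N] = l |: [set a in A | (a < k)%N].
    by apply/setP => a; rewrite !inE andb_orl; case: eqP => [->|]; rewrite ?lk.
  by rewrite cardsU1 !inE (negPf lA).
congr #|pred_of_set _|; apply/setP => a; rewrite !inE andb_orl.
by case: eqP => [->|//]; rewrite ltnNge lk andbF.
Qed.

Lemma ksignMM k A : ksign k A * ksign k A = 1.
Proof. by rewrite /ksign -expr2 sqrr_sign. Qed.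

Lemma ksign0 k : ksign k set0 = 1.
Proof.
by rewrite /ksign (_ : [set _ in _ | _] = set0) ?cards0 //; apply/setP => a;
  rewrite !inE.
Qed.

Lemma ksign_swap k l A : k \notin A -> l \notin A -> k != l ->
  ksign l A * ksign k (l |: A) = - (ksign k A * ksign l (k |: A)).
Proof.
move=> kA lA kl; rewrite !ksignU1 // mulrCA -!mulrN; congr (_ * (_ * _)).
by case: (ltngtP k l) kl; rewrite ?mulrN1 ?mulr1 ?expr0 ?expr1 ?opprK // => /val_inj ->;
  rewrite eqxx.
Qed.

Section Differential.
Variable E : lmodType F.
Implicit Type z : {set 'I_n} -> E.

(* A family [z] stands for \sum_A z_A e_A in E (x) Lambda F^n, and [kd] lowers
   the exterior degree #|A| by one. *)
Definition kd z A : E := \sum_(k | k \notin A) ksign k A *: z (k |: A).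

Lemma eq_kd z z' A : (forall k, k \notin A -> z (k |: A) = z' (k |: A)) ->
  kd z A = kd z' A.
Proof. by move=> e; apply: eq_bigr => k kA; rewrite e. Qed.

Lemma kdB z z' A : kd (fun B => z B - z' B) A = kd z A - kd z' A.
Proof.
by rewrite -sumrB; apply: eq_bigr => k _; rewrite scalerBr.
Qed.

(** The terms that add [k] and [l] in the two orders cancel by [ksign_swap], so the half of the
    double sum with l < k is matched with the other half. *)
Lemma kd_kd z A : kd (kd z) A = 0.
Proof.
pose c k l := (ksign k A * ksign l (k |: A)) *: z (l |: (k |: A)).
have -> : kd (kd z) A =
    \sum_(k | k \notin A) \sum_(l | (l \notin A) && (l != k)) c k l.
  apply: eq_bigr => k kA; rewrite scaler_sumr; apply: eq_big => l.
    by rewrite !inE negb_or andbC.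
  by rewrite scalerA.
have split k : k \notin A -> \sum_(l | (l \notin A) && (l != k)) c k l =
    \sum_(l | (l \notin A) && (l < k)%N) c k l +
    \sum_(l | (l \notin A) && (k < l)%N) c k l.
  move=> kA; rewrite (bigID (fun l : 'I_n => (l < k)%N)) /=.
  by congr (_ + _); apply: eq_bigl => l; rewrite -andbA; congr (_ && _);
    rewrite -(inj_eq val_inj) /=; case: ltngtP.
rewrite (eq_bigr _ split) big_split /=.
have -> : \sum_(k | k \notin A) \sum_(l | (l \notin A) && (l < k)%N) c k l =
    \sum_(k | k \notin A) \sum_(l | (l \notin A) && (k < l)%N) c l k.
  rewrite (exchange_big_dep (fun l => l \notin A)) /=; last by move=> ? ? _ /andP[].
  by apply: eq_bigr => l lA; apply: eq_bigl => k; rewrite lA.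
rewrite -big_split big1 // => k kA /=; rewrite -big_split big1 // => l /andP[lA kl].
rewrite /c setUCA ksign_swap ?scaleNr //= ?addNr //.
by apply: contraTneq kl => ->; rewrite ltnn.
Qed.

(** Exterior multiplication by e_j. *)
Definition kcontr j z A : E := if j \in A then ksign j (A :\ j) *: z (A :\ j) else 0.

(** As [kd] is the interior product with (1, ..., 1), it satisfies d(e_j z) = z - e_j dz; the
    hypothesis makes the last term vanish at [A]. *)
Lemma kd_kcontr j z A : (j \in A -> kd z (A :\ j) = 0) -> kd (kcontr j z) A = z A.
Proof.
case: (boolP (j \in A)) => jA dz; last first.
  rewrite /kd (bigD1 j) //= big1 => [|k /andP[kA kj]].
    by rewrite addr0 /kcontr setU11 setU1K // scalerA ksignMM scale1r.
  by rewrite /kcontr !inE eq_sym (negPf kj) (negPf jA) scaler0.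
(* With A = j |: B, the equation [kd z B = 0] is solved for its term at [k = j], and the result is
   compared with the goal term by term. *)
move: (dz isT) (setD1K jA) (setD11 j A); move: (A :\ j) => B {dz} + eA /negbT jB.
rewrite -{}eA in jA *; rewrite /kd (bigD1 j) //= => /(canRL (addrK _)); rewrite sub0r => eB.
have -> : z (j |: B) = ksign j B *: (ksign j B *: z (j |: B)).
  by rewrite scalerA ksignMM scale1r.
rewrite eB scalerN -scaleNr scaler_sumr; apply: eq_big => [k|k].
  by rewrite !inE negb_or andbC.
rewrite !inE negb_or => /andP[kj kB].
have eBk : (k |: (j |: B)) :\ j = k |: B.
  by rewrite setUCA setU1K // !inE negb_or eq_sym kj jB.
rewrite /kcontr !inE eqxx orbT eBk !scalerA mulNr.
congr (_ *: _); rewrite !ksignU1 // mulrACA -(exprD _ (j < k)%N).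
suff -> : ((j < k) + (k < j) = 1)%N by rewrite expr1 mulrN1 mulrC.
by case: ltngtP kj => // e; rewrite -(inj_eq val_inj) /= e eqxx.
Qed.

End Differential.
End KoszulFamilies.

(** * Koszul complexes of graded modules and Tor *)

Section KoszulModule.
Variables (n : nat) (F : fieldType).
Implicit Types (W P Q : gmodule n F) (u : grade n) (A B : {set 'I_n}).

Definition kdeg u A : grade n := gsub u (eset A).

Lemma gle_eset A B : A \subset B -> gle (eset A) (eset B).
Proof.
by move=> /subsetP AB; apply/gleP => i; rewrite !ffunE; case: (boolP (i \in A)) => // /AB ->.
Qed.

Lemma gle_gadd_setD1 (u v : grade n) k B :
  (v k < u k)%N -> gle (gadd v (eset (B :\ k))) u -> gle (gadd v (eset B)) u.
Proof.
move=> vk /gleP vB; apply/gleP => i; have := vB i; rewrite !ffunE !inE.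
by case: eqP => [-> _|//]; apply: leq_trans vk; rewrite -addn1 leq_add2l leq_b1.
Qed.

Lemma gle_esetW u A B : A \subset B -> gle (eset B) u -> gle (eset A) u.
Proof. by move=> /gle_eset; apply: gle_trans. Qed.

Lemma kdegS u A B : A \subset B -> gle (kdeg u B) (kdeg u A).
Proof.
move=> /gle_eset/gleP AB; apply/gleP => i.
by have := AB i; rewrite !ffunE; apply: leq_sub2l.
Qed.

Lemma gle_kdeg u A : gle (kdeg u A) u.
Proof. by apply/gleP => i; rewrite !ffunE leq_subr. Qed.

Lemma kdeg0 u : kdeg u set0 = u.
Proof. by apply/ffunP => i; rewrite !ffunE inE subn0. Qed.

Lemma eset0_le u : gle (eset set0) u.
Proof. by apply/gleP => i; rewrite !ffunE inE. Qed.

Lemma eset1 k : eset [set k] = gunit k :> grade n.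
Proof. by apply/ffunP => i; rewrite !ffunE inE. Qed.

(* The Koszul differential in grade [u]: the component of the Koszul complex
   W (x) Lambda F^n at [A] is W^(u - e_A), and [kdeg u A] = u - e_A is
   meaningful only when e_A <= u. *)
Definition kdm W u (w : forall A, W (kdeg u A)) A : W (kdeg u A) :=
  \sum_(k | (k \notin A) && gle (eset (k |: A)) u)
    ksign F k A *: gmul W (kdeg u (k |: A)) (kdeg u A) (w (k |: A)).

(* Only the components with #|A| = i matter. For i = 0 the cycle condition is
   void, and this says that (W / <x_1, ..., x_n> W)^u = 0. *)
Definition koszul_exact W u i : Prop :=
  forall w : forall A, W (kdeg u A),
    (forall A, gle (eset A) u -> #|A|.+1 = i -> kdm w A = 0) ->
    exists w' : forall A, W (kdeg u A),
      forall A, gle (eset A) u -> #|A| = i -> kdm w' A = w A.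

(** Brings the components at all B containing [A] into the space at [A], where the identities for
    [kd] apply; components outside N^n count as 0. *)
Definition kembed W u (w : forall A, W (kdeg u A)) A B : W (kdeg u A) :=
  if gle (eset B) u then gmul W (kdeg u B) (kdeg u A) (w B) else 0.

Lemma kdmE W u (w : forall A, W (kdeg u A)) A : kdm w A = kd (kembed w A) A.
Proof.
rewrite /kdm big_mkcondr; apply: eq_bigr => k kA; rewrite /kembed.
by case: ifP => _; rewrite ?scaler0.
Qed.

Lemma gmul_kdm W u (w : forall A, W (kdeg u A)) A B : A \subset B ->
  gmul W (kdeg u B) (kdeg u A) (kdm w B) = kd (kembed w A) B.
Proof.
move=> AB; rewrite kdmE linear_sum; apply: eq_bigr => k kB.
rewrite linearZ /= /kembed; case: ifP => _; rewrite ?linear0 //.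
by rewrite gmul_comp // kdegS // subsetUr.
Qed.

Lemma kdm_kdm W u (w : forall A, W (kdeg u A)) A : kdm (kdm w) A = 0.
Proof.
rewrite kdmE -(kd_kd (kembed w A) A); apply: eq_kd => k kA.
rewrite {1}/kembed; case: ifP => [_|ku]; first by rewrite gmul_kdm // subsetUr.
rewrite /kd big1 // => l _; rewrite /kembed; case: ifP => [lu|]; last by rewrite scaler0.
by rewrite (gle_esetW _ lu) ?subsetUr in ku.
Qed.

Lemma kdmB W u (w w' : forall A, W (kdeg u A)) A :
  kdm (fun B => w B - w' B) A = kdm w A - kdm w' A.
Proof.
by rewrite -sumrB; apply: eq_bigr => k _; rewrite linearB scalerBr.
Qed.

Lemma eq_kdm W u (w w' : forall A, W (kdeg u A)) A :
  (forall k, k \notin A -> gle (eset (k |: A)) u -> w (k |: A) = w' (k |: A)) ->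
  kdm w A = kdm w' A.
Proof. by move=> e; apply: eq_bigr => k /andP[kA ku]; rewrite e. Qed.

Lemma kdm_natural W P (f : forall u, 'Hom(W u, P u))
    (fN : forall u v x, gle u v -> f v (gmul W u v x) = gmul P u v (f u x))
    u (w : forall A, W (kdeg u A)) A :
  kdm (fun B => f (kdeg u B) (w B)) A = f (kdeg u A) (kdm w A).
Proof.
rewrite linear_sum; apply: eq_bigr => k _.
by rewrite linearZ /= fN // kdegS // subsetUr.
Qed.

(** Multiplication by 1 serves as transport between the components at provably equal grades, such as
    [kdeg u set0] and [u]. *)
Lemma gmulK W u v x : u = v -> gmul W v u (gmul W u v x) = x.
Proof. by move=> e; rewrite gmul_comp ?e ?gle_refl // gmul_id. Qed.

(** In exterior degree 0 all signs are 1, and the Koszul differential is the sum of the x_j w_j. *)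
Lemma maxidealP W u x :
  reflect (exists w : forall A, W (kdeg u A),
      x = gmul W (kdeg u set0) u (kdm w set0))
    (x \in maxideal_mul W u).
Proof.
apply: (iffP idP) => [/memv_sumP[y yP ->]|[w ->]].
  pose z k := (gmul W (gsub u (gunit k)) u)^-1%VF (y k).
  (* At a singleton {k} this is [z k], up to transport; the values at other sets do not enter [kdm]
     at [set0]. *)
  exists (fun A => \sum_(k in A) gmul W (gsub u (gunit k)) (kdeg u A) (z k)).
  rewrite linear_sum; apply: eq_big => [k|k ku].
    by rewrite inE setU0 eset1.
  rewrite (big_pred1 k) => [|i]; last by rewrite !inE orbF.
  rewrite ksign0 scale1r; rewrite -{1}(limg_lfunVK (yP k ku)) -/(z k).
  have e : kdeg u (k |: set0) = gsub u (gunit k) by rewrite /kdeg setU0 eset1.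
  have le0 : gle (kdeg u (k |: set0)) (kdeg u set0) by rewrite kdegS ?sub0set.
  by rewrite gmul_comp -?e ?gle_refl //= gmul_comp ?gle_kdeg // -e.
rewrite linear_sum; apply: memv_suml => k /andP[_ ku].
rewrite ksign0 scale1r /= gmul_comp ?gle_kdeg ?kdegS ?sub0set //.
apply: subv_trans (memv_img _ (memvf _)) _.
have ku' : gle (gunit k) u by rewrite -eset1 -(setU0 [set k]).
have -> : kdeg u (k |: set0) = gsub u (gunit k) by rewrite /kdeg setU0 eset1.
exact: (sumv_sup k).
Qed.

Lemma maxideal_natural P Q u (d : forall v, 'Hom(P v, Q v)) x :
  (forall v w x, gle v w -> d w (gmul P v w x) = gmul Q v w (d v x)) ->
  x \in maxideal_mul P u -> d u x \in maxideal_mul Q u.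
Proof.
move=> dN /maxidealP[w ->]; apply/maxidealP.
exists (fun A => d _ (w A)); by rewrite dN ?gle_kdeg // kdm_natural.
Qed.

(** By naturality [d] respects multiples of the maximal ideal, so the representative chosen by
    [qrepr] does not matter. *)
Lemma tensF_mapE P Q u (d : forall v, 'Hom(P v, Q v)) x :
  (forall v w x, gle v w -> d w (gmul P v w x) = gmul Q v w (d v x)) ->
  tensF_map (d u) (qproj fullv (maxideal_mul P u) x) =
  qproj fullv (maxideal_mul Q u) (d u x).
Proof.
move=> dN; rewrite /tensF_map 2!comp_lfunE; apply/eqP; rewrite -subr_eq0 -!linearB /=.
rewrite qproj_eq0 ?memvf // (maxideal_natural dN) //.
by rewrite qproj_repr_sub ?memvf.
Qed.

Lemma betti_eq0 W i u :
  (tor_cycles W i u <= tor_boundaries W i u)%VS -> betti W i u = 0%N.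
Proof.
by rewrite -diffv_eq0 => /eqP e; rewrite /betti dimvf /Tor /qspace; rewrite e; exact: dimv0.
Qed.

Lemma cover_lift W u (w : W u) : cover_map W u ((cover_map W u)^-1%VF w) = w.
Proof. by apply: limg_lfunVK; rewrite cover_map_surj memvf. Qed.

Lemma cover_lift_kdm W u (w : forall A, W (kdeg u A)) A :
  cover_map W _ (kdm (fun B => (cover_map W (kdeg u B))^-1%VF (w B)) A) = kdm w A.
Proof.
rewrite -(kdm_natural (@cover_map_natural _ _ W)).
by apply: eq_kdm => k _ _; rewrite cover_lift.
Qed.

(** Lifting coefficients through the cover P gives an element of mP with the same image as [p], for
    m the maximal ideal; the difference is a syzygy, hence in the image of the resolution. *)
Lemma cover_maxideal W u (p : Defs.cover W u) :
  cover_map W u p \in maxideal_mul W u ->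
  qproj fullv (maxideal_mul (Defs.cover W) u) p \in tor_boundaries W 0 u.
Proof.
case/maxidealP=> w ew; set M := maxideal_mul _ u.
pose m : Defs.cover W u := gmul (Defs.cover W) (kdeg u set0) u
  (kdm (fun A => (cover_map W (kdeg u A))^-1%VF (w A)) set0).
have mM : m \in M by apply/maxidealP; eexists.
have : p - m \in limg (res_diff W 0 u).
  rewrite res_exact0 memv_ker linearB /= cover_map_natural ?gle_kdeg //.
  by rewrite cover_lift_kdm ew subrr.
case/memv_imgP => s _ es.
have -> : qproj fullv M p = tensF_map (res_diff W 0 u) (qproj fullv _ s).
  rewrite (tensF_mapE (d := res_diff W 0)); last exact: res_diff_natural.
  have m0 : qproj fullv M m = 0 by apply/eqP; rewrite qproj_eq0 ?memvf.
  by rewrite -es linearB /= m0 subr0.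
exact: memv_img (memvf _).
Qed.

Lemma betti0_koszul W u : koszul_exact W u 0 -> betti W 0 u = 0%N.
Proof.
move=> ex; apply: betti_eq0; apply/subvP => t _.
rewrite -[t]qreprK; apply: cover_maxideal; set p := qrepr _ _ t.
have [|w ew] := ex (fun A => gmul W u (kdeg u A) (cover_map W u p)) => //.
apply/maxidealP; exists w; rewrite ew ?cards0 ?eset0_le //.
by rewrite gmulK // kdeg0.
Qed.

Lemma syz_incl_natural W u v x : gle u v ->
  syz_incl W v (gmul (syz W) u v x) = gmul (Defs.cover W) u v (syz_incl W u x).
Proof. by move=> uv; rewrite !(lfunE vsval) /= val_syz_mul. Qed.

Lemma syz_incl_inj W u : injective (syz_incl W u).
Proof. by move=> x y; rewrite !(lfunE vsval); apply: val_inj. Qed.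

Lemma cover_syz_incl W u k : cover_map W u (syz_incl W u k) = 0.
Proof. by rewrite (lfunE vsval); have := subvsP k; rewrite memv_ker => /eqP. Qed.

Definition syz_proj W u (p : Defs.cover W u) : syz W u :=
  vsproj (lker (cover_map W u)) p.

Lemma syz_projK W u p : cover_map W u p = 0 -> syz_incl W u (syz_proj p) = p.
Proof. by move=> p0; rewrite (lfunE vsval) /syz_proj /= vsprojK // memv_ker p0. Qed.

(* With K the syzygies in a cover P of W and m the irrelevant ideal, Tor_1 of W
   is (K :&: mP) / mK. If an element of K is \sum_j x_j p_j, the images of the
   p_j in W form a Koszul 1-cycle; if this is a boundary, the p_j can be
   corrected to lie in K. *)
Lemma betti_koszul V i u :
  koszul_exact (iter i (@syz n F) V) u 1 -> betti V i.+1 u = 0%N.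
Proof.
set W := iter i _ V => ex; apply: betti_eq0; apply/subvP => t.
rewrite memv_ker -[t]qreprK; set p : Defs.cover (syz W) u := qrepr _ _ t.
rewrite (tensF_mapE (d := res_diff V i)); last exact: res_diff_natural.
rewrite qproj_eq0 ?memvf // => /maxidealP[w ew].
(* The boundaries for [V] in degree i + 1 are, by unfolding, those for [syz W] in degree 0. *)
apply: (@cover_maxideal (syz W)).
have {}ew : syz_incl W u (cover_map (syz W) u p) =
    gmul (Defs.cover W) (kdeg u set0) u (kdm w set0).
  by rewrite -ew /res_diff comp_lfunE.
have w0 : kdm (fun A => cover_map W _ (w A)) set0 = 0.
  rewrite (kdm_natural (@cover_map_natural _ _ W)).
  rewrite -[LHS](gmulK (v := u)) ?kdeg0 // -cover_map_natural ?gle_kdeg //.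
  by rewrite -ew cover_syz_incl linear0.
have [A _ []/eqP|w' ew'] := ex (fun A => cover_map W _ (w A)).
  by rewrite cards_eq0 => /eqP ->.
pose p' A := (cover_map W (kdeg u A))^-1%VF (w' A).
pose k A := syz_proj (w A - kdm p' A).
apply/maxidealP; exists k; apply: syz_incl_inj; rewrite ew.
rewrite syz_incl_natural ?gle_kdeg // -(kdm_natural (@syz_incl_natural W)).
congr (gmul _ _ _ _); rewrite -[LHS]subr0 -(kdm_kdm p' set0) -kdmB.
apply: eq_kdm => j _ ju; rewrite syz_projK // linearB /= cover_lift_kdm.
by rewrite ew' ?subrr // setU0 cards1.
Qed.

(** Dimension shifting: a cycle of syzygies bounds some [p] in the cover, the image of [p] in [W] is
    a cycle and so bounds some [w'], and subtracting the differential of a lift of [w'] moves [p]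
    into the syzygies without changing its boundary. *)
Lemma koszul_exact_syz W u i :
  koszul_exact (Defs.cover W) u i.+1 -> koszul_exact W u i.+2 ->
  koszul_exact (syz W) u i.+1.
Proof.
move=> exP exW k dk.
have [A Au Ai|p ep] := exP (fun A => syz_incl W _ (k A)).
  by rewrite (kdm_natural (@syz_incl_natural W)) dk ?linear0.
have [A Au Ai|w' ew'] := exW (fun A => cover_map W _ (p A)).
  rewrite (kdm_natural (@cover_map_natural _ _ W)) ep ?cover_syz_incl //.
  by case: Ai.
pose p' A := (cover_map W (kdeg u A))^-1%VF (w' A).
exists (fun A => syz_proj (p A - kdm p' A)) => A Au Ai.
apply: syz_incl_inj; rewrite -(kdm_natural (@syz_incl_natural W)).
rewrite -ep // -[RHS]subr0 -(kdm_kdm p' A) -kdmB.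
apply: eq_kdm => j jA ju; rewrite syz_projK // linearB /= cover_lift_kdm.
by rewrite ew' ?subrr // cardsU1 jA Ai.
Qed.

End KoszulModule.

(** * Koszul acyclicity of free modules in positive degrees *)

Section KoszulFree.
Variables (n : nat) (F : fieldType) (g : grade n -> nat).
Implicit Types (u v : grade n) (A : {set 'I_n}) (r : grade n * nat).

Definition fcoef u r (f : free_comp F g u) : F := \sum_(p | ssval p == r) f p.

Lemma fcoef_ssval u (f : free_comp F g u) p : fcoef (ssval p) f = f p.
Proof. by rewrite /fcoef (big_pred1 p). Qed.

Lemma fcoef_out u r (f : free_comp F g u) : ~~ gle r.1 u -> fcoef r f = 0.
Proof.
move=> ru; rewrite /fcoef big_pred0 // => -[p pu] /=; apply/eqP => e.
by move: pu; rewrite mem_fgens e (negPf ru).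
Qed.

Fact fcoef_linear u r : linear (@fcoef u r : _ -> F^o).
Proof.
move=> a f h; rewrite /fcoef scaler_sumr -big_split.
by apply: eq_bigr => p _; rewrite !ffunE.
Qed.
HB.instance Definition _ u r :=
  GRing.isLinear.Build F (free_comp F g u) F^o *:%R (@fcoef u r) (@fcoef_linear u r).

Lemma fcoef_mul u v r f : gle u v ->
  fcoef r (free_mul F g u v f) = fcoef r f.
Proof.
move=> uv; case: (boolP (r \in fgens g v)) => rv; last first.
  rewrite /fcoef !big_pred0 // => p; apply: contraNF rv => /eqP <-.
    exact: fgens_widen uv.
  exact: (valP p).
by rewrite -[r]/(ssval (SeqSub rv)) fcoef_ssval free_mulE.
Qed.

Definition kcoef u (w : forall A, free_comp F g (kdeg u A)) r A : F^o :=
  if gle (eset A) u then fcoef r (w A) else 0.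

Lemma kd_kcoef u (w : forall A, free_module F g (kdeg u A)) r A :
  gle (eset A) u -> fcoef r (kdm w A) = kd (kcoef w r) A.
Proof.
move=> Au; rewrite linear_sum /kd big_mkcondr; apply: eq_bigr => k kA.
rewrite /kcoef; case: ifP => ku; rewrite ?scaler0 // linearZ /= fcoef_mul //.
by rewrite kdegS ?subsetUr.
Qed.

Lemma kcoef_neq0 u (w : forall A, free_comp F g (kdeg u A)) r A :
  kcoef w r A != 0 -> gle (gadd r.1 (eset A)) u.
Proof.
rewrite /kcoef; case: ifP => [Au|]; last by rewrite eqxx.
by rewrite -gle_gadd //; apply: contraNT => /fcoef_out ->.
Qed.

(* The free module on one generator [r] is contracted in a direction [k] along
   which [r] lives strictly below [u]; if there is none, the Koszul complex of
   this summand is concentrated in degree 0. *)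
Lemma koszul_exact_free u i : koszul_exact (free_module F g) u i.+1.
Proof.
move=> w dw.
pose z' r A := if [pick k | (r.1 k < u k)%N] is Some k
  then kcontr k (kcoef w r) A else 0.
have z'_le r A : z' r A != 0 -> gle (gadd r.1 (eset A)) u.
  rewrite /z'; case: pickP => [k rk|_]; last by rewrite eqxx.
  rewrite /kcontr; case: ifP => [kA|]; last by rewrite eqxx.
  rewrite scaler_eq0 negb_or => /andP[_ /kcoef_neq0].
  exact: gle_gadd_setD1.
pose w' A : free_module F g (kdeg u A) := [ffun p => z' (ssval p) A].
exists w' => A Au Ai; apply/ffunP => p; rewrite -!fcoef_ssval.
have rg : ((ssval p).2 < g (ssval p).1)%N.
  by have := valP p; rewrite mem_fgens => /andP[].
move: (ssval p) rg => r rg; rewrite kd_kcoef //.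
(* Where [z' r] is nonzero, [r] lives in grade [kdeg u B], so recording [z'] only on the generators
   of that grade loses nothing. *)
have e B : kcoef w' r B = z' r B.
  have [z0|/z'_le ru] := eqVneq (z' r B) 0.
    rewrite z0 /kcoef; case: ifP => // _; rewrite /fcoef big1 // => q /eqP qr.
    by rewrite ffunE qr.
  have Bu : gle (eset B) u.
    by apply: gle_trans ru; apply/gleP => k; rewrite !ffunE leq_addl.
  have rB : r \in fgens g (kdeg u B) by rewrite mem_fgens gle_gadd // ru.
  by rewrite /kcoef Bu -[r]/(ssval (SeqSub rB)) fcoef_ssval ffunE.
rewrite (eq_kd (z' := z' r)) //.
have <- : kcoef w r A = fcoef r (w A) by rewrite /kcoef Au.
rewrite /z'; case: pickP => [k rk|rn].
  apply: kd_kcontr => kA; rewrite -kd_kcoef.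
    by rewrite dw ?linear0 ?(gle_esetW _ Au) ?subD1set // -Ai [RHS](cardsD1 k) kA.
  by rewrite (gle_esetW _ Au) ?subD1set.
rewrite /kd big1 => [|k _]; last by rewrite scaler0.
apply/esym/eqP/negPn/negP => /kcoef_neq0 /gleP rA.
have /card_gt0P[k kA] : (0 < #|A|)%N by rewrite Ai.
by have := rA k; have := rn k; rewrite !ffunE kA addn1 => ->.
Qed.

End KoszulFree.

Lemma koszul_exact_iter_syz n F (V : gmodule n F) u i :
  koszul_exact V u i.+1 -> koszul_exact (iter i (@syz n F) V) u 1.
Proof.
(* The final degree is left free for the induction, since each syzygy trades one iteration for one
   exterior degree. *)
suff gen k : koszul_exact V u (i + k.+1) -> koszul_exact (iter i (@syz n F) V) u k.+1.
  by rewrite -addn1; apply: gen.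
elim: i k => //= i IH k; rewrite addSnnS => /IH.
by apply: koszul_exact_syz; apply: koszul_exact_free.
Qed.

Lemma betti_eq0_koszul n F (V : gmodule n F) u i : koszul_exact V u i -> betti V i u = 0%N.
Proof.
case: i => [|i]; first exact: betti0_koszul.
by move/koszul_exact_iter_syz; apply: betti_koszul.
Qed.

(** * Koszul complexes of families of subspaces *)

Section KoszulSubspaces.
Variables (F : fieldType) (n : nat) (E : vectType F).
Implicit Types (U Z B : {set 'I_n} -> {vspace E}) (A : {set 'I_n}).

(* Exactness in degree i of the Koszul complex of a family of subspaces of E,
   where U A is the component in grade u - e_A and the variables act by
   inclusion. *)
Definition sub_exact U i : Prop :=
  forall z : {set 'I_n} -> E, (forall A, z A \in U A) ->
    (forall A, #|A|.+1 = i -> kd z A = 0) ->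
    exists2 z', forall A, z' A \in U A & forall A, #|A| = i -> kd z' A = z A.

(* The same for the quotients Z A / B A. *)
Definition pair_exact Z B i : Prop :=
  forall z : {set 'I_n} -> E, (forall A, z A \in Z A) ->
    (forall A, #|A|.+1 = i -> kd z A \in B A) ->
    exists2 z', forall A, z' A \in Z A &
      forall A, #|A| = i -> z A - kd z' A \in B A.

Lemma pair_exact0 Z B : sub_exact Z 0 -> pair_exact Z B 0.
Proof.
move=> exZ z zZ _; have [//|z' z'Z ez'] := exZ z zZ; exists z' => // A A0.
by rewrite ez' // subrr mem0v.
Qed.

(** The family dz is a cycle of [B], hence the boundary of some b in [B]; then z - b is a cycle of
    [Z], hence a boundary. *)
Lemma pair_exactS Z B i : (forall A, (B A <= Z A)%VS) ->
  sub_exact Z i.+1 -> sub_exact B i -> pair_exact Z B i.+1.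
Proof.
move=> BZ exZ exB z zZ dz.
(* Outside degree i, dz need not lie in [B], so it is replaced by 0 there. *)
have [A|A Ai|b bB eb] := exB (fun A => if #|A| == i then kd z A else 0).
- by case: eqP => [Ai|_]; [apply: dz; rewrite Ai | apply: mem0v].
- rewrite -(kd_kd z A); apply: eq_kd => k kA.
  by rewrite cardsU1 kA add1n Ai eqxx.
have [A|A [Ai]|z' z'Z ez'] := exZ (fun A => z A - b A).
- by rewrite rpredB // (subvP (BZ A)).
- by rewrite kdB eb // Ai eqxx subrr.
by exists z' => // A Ai; rewrite ez' // subKr.
Qed.

(** The inclusions keep [kcontr j] inside the family, which it therefore contracts. *)
Lemma sub_exact_contr j U i :
  (forall A, j \in A -> (U (A :\ j) <= U A)%VS) -> sub_exact U i.
Proof.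
move=> Uj z zU dz; exists (kcontr j z) => A.
  rewrite /kcontr; case: ifP => jA; last by rewrite mem0v.
  by rewrite memvZ // (subvP (Uj A jA)).
move=> Ai; apply: kd_kcontr => jA; apply: dz.
by rewrite -Ai [RHS](cardsD1 j) jA.
Qed.

Lemma sub_exact0 U : (U set0 <= \sum_j U [set j])%VS -> sub_exact U 0.
Proof.
move=> /subvP U0 z zU _; have /memv_sumP[x xU ex] := U0 _ (zU set0).
exists (fun A => \sum_(j | A == [set j]) x j) => [A|A /cards0_eq ->].
  by apply: memv_suml => j /eqP ->; apply: xU.
rewrite ex; apply: eq_big => [k|k _]; first by rewrite inE.
rewrite ksign0 scale1r (big_pred1 k) // => j.
by rewrite setU0 (inj_eq set1_inj) eq_sym.
Qed.

(* By induction on the last index l with [x l != 0]: the hypothesis on U1 and U2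
   distributes [x l] over the indices before l. *)
Lemma antisymmetric_family (U1 : 'I_n -> {vspace E})
    (U2 : 'I_n -> 'I_n -> {vspace E}) (x : 'I_n -> E) :
  (forall i j, U2 i j = U2 j i) -> (forall i j, (U2 i j <= U1 i)%VS) ->
  (forall l, (U1 l :&: \sum_(j < n | (j < l)%N) U1 j <=
              \sum_(j < n | (j < l)%N) U2 j l)%VS) ->
  (forall j, x j \in U1 j) -> \sum_j x j = 0 ->
  exists y : 'I_n -> 'I_n -> E,
    [/\ forall i j, y i j \in U2 i j, forall i j, y i j = - y j i,
        forall i, y i i = 0 & forall j, \sum_i y i j = x j].
Proof.
move=> U2C U21 ex xU x0.
have gen m : forall x : 'I_n -> E, (forall j, x j \in U1 j) ->
    \sum_j x j = 0 -> (forall j : 'I_n, (m <= j)%N -> x j = 0) ->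
    exists y : 'I_n -> 'I_n -> E,
    [/\ forall i j, y i j \in U2 i j, forall i j, y i j = - y j i,
        forall i, y i i = 0 & forall j, \sum_i y i j = x j]; last first.
  by apply: (gen n) => // j; rewrite leqNgt ltn_ord.
elim: m => {xU x0}[|m IH] {}x xU x0 xm.
  exists (fun _ _ => 0); split=> // [i j|i j|j]; rewrite ?mem0v ?oppr0 //.
  by rewrite xm // big1.
have [nm|mn] := leqP n m.
  by apply: IH => // j mj; have := leq_trans (ltn_ord j) nm; rewrite ltnNge mj.
pose l := Ordinal mn.
have xl : x l \in (\sum_(j < n | (j < l)%N) U2 j l)%VS.
  apply: (subvP (ex l)); rewrite memv_cap xU /=.
  have -> : x l = - \sum_(j < n | (j < l)%N) x j.
    move: x0; rewrite (bigD1 l) //= (bigID (fun j : 'I_n => (j < l)%N)) /=.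
    rewrite [X in _ + (_ + X)]big1 ?addr0 => [|j /andP[jl]]; last first.
      by rewrite -leqNgt => lj; rewrite xm // ltn_neqAle lj andbT eq_sym.
    move/eqP; rewrite addr_eq0 => /eqP ->; congr (- _); apply: eq_bigl => j.
    by case: eqP => [->|//]; rewrite ltnn.
  by rewrite rpredN; apply: memv_sumr.
have [a aU ea] := memv_sumP xl.
pose a' (j : 'I_n) := if (j < l)%N then a j else 0.
have a'U j : a' j \in U2 j l by rewrite /a'; case: ifP => [/aU|_]; rewrite ?mem0v.
have a'l : a' l = 0 by rewrite /a' ltnn.
have ea' : \sum_j a' j = x l by rewrite ea [RHS]big_mkcond.
(* Spreading the last nonzero entry over the earlier ones keeps the sum 0 and lowers the bound to
   m. *)
pose x' (j : 'I_n) := if j == l then 0 else x j + a' j.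
have [j||j mj|y [yU yC y0 ey]] := IH x'.
- by rewrite /x'; case: eqP => _; rewrite ?mem0v // rpredD ?xU // (subvP (U21 j l)).
- rewrite (bigD1 l) //= /x' eqxx add0r.
  rewrite (eq_bigr (fun j => x j + a' j)) => [|j /negPf -> //].
  move: x0 ea'; rewrite big_split (bigD1 l) //= (bigD1 l (P := xpredT) (F := a')) //=.
  by rewrite a'l add0r => x0 ->; rewrite addrC.
- rewrite /x'; case: eqP => // /eqP jl.
  rewrite /a' ltnNge mj addr0 xm // ltn_neqAle mj andbT.
  by rewrite eq_sym.
(* Adding [a'] to column l and subtracting it from row l keeps antisymmetry and turns the column
   sums [x'] back into [x]. *)
exists (fun i j => y i j + ((if j == l then a' i else 0) - (if i == l then a' j else 0))).
split=> [i j|i j|i|j].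
- rewrite rpredD // rpredB //; case: eqP => [->|_]; rewrite ?mem0v //.
  by rewrite U2C.
- by rewrite yC opprD opprB.
- by rewrite y0 subrr addr0.
rewrite big_split ey sumrB /=.
rewrite -(big_mkcond (fun i => i == l) (fun=> a' j)) big_pred1_eq /x' /=.
case: eqP => [->|_]; first by rewrite ea' a'l subr0 add0r.
by rewrite big1_eq sub0r addrK.
Qed.

(** A 1-cycle is a family of vectors with sum 0; an antisymmetric array with these vectors as column
    sums is a 2-chain bounding it. The permutation only orders the directions. *)
Lemma sub_exact1 U (rho : 'S_n) :
  (forall k l, (U [set k; l] <= U [set k])%VS) ->
  (forall l, (U [set rho l] :&: \sum_(j < n | (j < l)%N) U [set rho j] <=
              \sum_(j < n | (j < l)%N) U [set rho j; rho l])%VS) ->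
  sub_exact U 1.
Proof.
move=> U21 ex z zU dz.
have [|||||y [yU yC y0 ey]] := @antisymmetric_family (fun j => U [set rho j])
    (fun i j => U [set rho i; rho j]) (fun j => z [set rho j]) => //.
- by move=> i j; rewrite setUC.
- rewrite -[RHS](dz set0) ?cards0 // /kd [RHS](reindex_inj (@perm_inj _ rho)) /=.
  by apply: eq_big => [k|k _]; rewrite ?inE // ksign0 scale1r setU0.
pose Y k l := y (rho^-1%g k) (rho^-1%g l).
(* A two-element set is listed in the natural order of its elements, not that of [rho]; antisymmetry
   of [Y] then matches [ksign]. *)
pose z' A := if [pick p : 'I_n * 'I_n | (p.1 < p.2)%N && (A == [set p.1; p.2])]
  is Some p then Y p.1 p.2 else 0.
have z'E k l : k != l -> ksign F k [set l] *: z' (k |: [set l]) = Y k l.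
  have e (a b : 'I_n) : (a < b)%N -> z' [set a; b] = Y a b.
    move=> ab; rewrite /z'; case: pickP => [[c d] /= /andP[cd /eqP eab]|/(_ (a, b))].
      have : c \in [set a; b] by rewrite eab set21.
      have : d \in [set a; b] by rewrite eab set22.
      by rewrite !inE; do 2!case/orP => /eqP ?; subst c d => //;
        rewrite ?ltnn // ltnNge (ltnW ab) in cd.
    by rewrite /= ab eqxx.
  case: (ltngtP k l) => [lk _|lk _|/val_inj -> /eqP //].
  - rewrite e // -[set1 l]setU0 ksignU1 ?inE // ksign0 ltnNge (ltnW lk) expr0 mul1r.
    by rewrite scale1r.
  - rewrite setUC e // -[set1 l]setU0 ksignU1 ?inE // ksign0 lk expr1 mul1r scaleN1r.
    by rewrite -yC.
exists z' => [A|A /eqP/cards1P[l ->]].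
  rewrite /z'; case: pickP => [[k l] /= /andP[_ /eqP ->]|_]; last exact: mem0v.
  by have := yU (rho^-1%g k) (rho^-1%g l); rewrite !permKV.
have <- : \sum_k Y k l = z [set l].
  rewrite (reindex_inj (@perm_inj _ rho)) /Y /=.
  under eq_bigr do rewrite permK.
  by rewrite ey permKV.
rewrite (bigD1 l) //= {1}/Y y0 add0r; apply: eq_big => [k|k]; first by rewrite inE.
by rewrite inE; apply: z'E.
Qed.

End KoszulSubspaces.

(** * Supports of chains and Koszul acyclicity of chain spaces *)

Section ChainSupport.
Variables (F : fieldType) (K : gradedCells F).
Implicit Types (c : chain K) (A : {set K}).

Lemma mem_Cq q A c :
  reflect (forall s, c s != 0 -> (s \in A) && (cdim s == q)) (c \in Cq q A).
Proof.
apply: (iffP idP) => [cA s|cA].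
  pose L := [seq s <- enum A | cdim s == q].
  apply: contraNT => sA; rewrite (coord_span (X := in_tuple [seq cell_chain s | s <- L]) cA).
  rewrite sum_ffunE big1 // => i _.
  have iL : (i < size L)%N by rewrite -(size_map (@cell_chain F K)) ltn_ord.
  rewrite ffunE (nth_map s) // ffunE; case: eqP => [e|_]; last by rewrite scaler0.
  have : s \in L by rewrite {1}e mem_nth.
  by rewrite mem_filter mem_enum andbC (negPf sA).
have -> : c = \sum_s c s *: cell_chain s.
  apply/ffunP => s; rewrite sum_ffunE (bigD1 s) //= big1 => [|t ts].
    by rewrite !ffunE eqxx addr0 [_ *: _]mulr1.
  by rewrite !ffunE eq_sym (negPf ts) scaler0.
apply: memv_suml => s _; have [->|/cA/andP[sA sq]] := eqVneq (c s) 0.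
  by rewrite scale0r mem0v.
by apply/memvZ/memv_span/map_f; rewrite mem_filter mem_enum sA sq.
Qed.

Lemma boundaryE c s : boundary K c s = \sum_t (c t : F) * kappa t s.
Proof. by rewrite lfunE ffunE. Qed.

Lemma kd_chain n (z : {set 'I_n} -> chain K) B s :
  kd z B s = kd (fun B => z B s : F^o) B.
Proof. by rewrite sum_ffunE; apply: eq_bigr => k _; rewrite ffunE. Qed.

(* A cell [c] is contracted in a direction along which [h c] is strictly below
   [u]. *)
Lemma sub_exact_Cq n (h : K -> grade n) u q i (S : {set 'I_n} -> {set K}) :
  (forall B, S B = [set c | gle (gadd (h c) (eset B)) u]) ->
  sub_exact (fun B => Cq q (S B)) i.+1.
Proof.
move=> eS z zS dz.
have zP B s : z B s != 0 -> gle (gadd (h s) (eset B)) u && (cdim s == q).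
  by move=> zs; have /mem_Cq/(_ s zs) := zS B; rewrite eS inE.
pose dir s := [pick k | (h s k < u k)%N].
have dirP s k : dir s = Some k -> (h s k < u k)%N.
  by rewrite /dir; case: pickP => // l ? [<-].
pose z' B : chain K := [ffun s => if dir s is Some k
  then kcontr k (fun B => z B s : F^o) B else 0].
exists z' => A; last first.
  move=> Ai; apply/ffunP => s; rewrite kd_chain.
  case e : (dir s) => [k|].
    rewrite (eq_kd (z' := kcontr k (fun B => z B s : F^o))) => [|j _].
      apply: kd_kcontr => kA; rewrite -kd_chain dz ?ffunE //.
      by rewrite -Ai [RHS](cardsD1 k) kA.
    by rewrite ffunE e.
  rewrite /kd big1 => [|k _]; last by rewrite ffunE e scaler0.
  apply/esym/eqP/negPn/negP => /zP /andP[/gleP rA _].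
  have /card_gt0P[k kA] : (0 < #|A|)%N by rewrite Ai.
  move: e (rA k); rewrite /dir; case: pickP => // rn _.
  by have := rn k; rewrite !ffunE kA addn1 => ->.
apply/mem_Cq => s; rewrite ffunE; case e : (dir s) => [k|]; last by rewrite eqxx.
rewrite /kcontr; case: ifP => [kA|]; last by rewrite eqxx.
rewrite scaler_eq0 negb_or eS inE => /andP[_ /zP /andP[sA ->]]; rewrite andbT.
exact: gle_gadd_setD1 (dirP _ _ e) sA.
Qed.

End ChainSupport.

(** * Sums over gradient paths *)

Lemma forall_ord_recl k (P : pred 'I_k.+1) :
  [forall i, P i] = P ord0 && [forall i, P (lift ord0 i)].
Proof.
apply/forallP/andP => [h|[h0 /forallP h] i]; first by split=> //; apply/forallP.
by case: (unliftP ord0 i) => [j|] ->.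
Qed.

Section TupleSums.
Variables (R : nmodType) (T : finType).

Lemma big_tuple0 (f : seq T -> R) (P : pred (seq T)) :
  \sum_(t : 0.-tuple T | P t) f t = if P [::] then f [::] else 0.
Proof.
rewrite big_mkcond (big_pred1 [tuple]) // => t.
by apply/esym/eqP; apply: tuple0.
Qed.

Lemma big_tupleS k (f : seq T -> R) (P : pred (seq T)) :
  \sum_(t : k.+1.-tuple T | P t) f t =
  \sum_x \sum_(t : k.-tuple T | P (x :: t)) f (x :: t).
Proof.
rewrite pair_big_dep /= (reindex (fun p : T * k.-tuple T => [tuple of p.1 :: p.2])) //=.
exists (fun t => (thead t, [tuple of behead t])) => [[x t]|t] _ /=.
  by rewrite theadE; congr pair; apply: val_inj.
by rewrite -tuple_eta.
Qed.

Lemma big_bseq m (f : seq T -> R) (P : pred (seq T)) :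
  \sum_(p : {bseq m of T} | P p) f p =
  \sum_(k < m.+1) \sum_(t : k.-tuple T | P t) f t.
Proof.
rewrite (sig_big_dep (I := 'I_m.+1) (J := fun k => (k : nat).-tuple T : finType) (fun=> true)
  (fun k t => P (t : _.-tuple T)) (fun k t => f (t : _.-tuple T))) /=.
by rewrite (reindex (@bseq_tagged_tuple m T)) //=; apply: onW_bij.
Qed.

End TupleSums.

Section GradientPaths.
Variables (F : fieldType) (X : cellComplex F) (V : {set X * X}).
Implicit Types (p : seq (X * X)) (e s t x y : X).

(** A recursive form of [gradient_path] that admits the empty path, which will account for the term
    [kappa t s] of [kappa_morse]. *)
Fixpoint gpath p e : bool :=
  if p is st :: p' then
    [&& st \in V, facet (path_s p' e 0) st.2, path_s p' e 0 != st.1 & gpath p' e]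
  else true.

Lemma gradient_pathE p e : gradient_path V p e = (0 < size p)%N && gpath p e.
Proof.
rewrite /gradient_path; congr (_ && _); elim: p => [|[s t] p IH].
  by apply/forallP => -[].
rewrite forall_ord_recl /= -IH /path_s /path_t /= -andbA.
congr (_ && _); rewrite !andbA; congr (_ && _).
by rewrite -andbA andbC.
Qed.

Lemma gpath_cat p q e : gpath (p ++ q) e = gpath p (path_s q e 0) && gpath q e.
Proof.
elim: p => //= -[s t] p ->; rewrite -!andbA.
by have -> : path_s (p ++ q) e 0 = path_s p (path_s q e 0) 0 by case: p => [|[]].
Qed.

Hypothesis hV : discrete_gradient_vector_field V.

(** Between two occurrences of the same source, the path would be a closed gradient path. *)
Lemma gpath_uniq p e : gpath p e -> uniq (unzip1 p).
Proof.
elim: p e => //= -[s t] p IH e /= gp.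
have /and4P[stV _ _ /IH ->] := gp; rewrite andbT.
apply/negP => /mapP[[s' t'] stp /= e'].
have [p1 [p2 ep]] : exists p1 p2, p = p1 ++ (s', t') :: p2.
  by case/path.splitPr: stp => p1 p2; exists p1, p2.
have : gpath (((s, t) :: p1) ++ (s', t') :: p2) e by rewrite cat_cons -ep.
have es : path_s ((s', t') :: p2) e 0 = s by rewrite e'.
rewrite gpath_cat es => /andP[gps _].
by have /(_ ((s, t) :: p1) s) := hV.2; rewrite gradient_pathE gps => /(_ isT).
Qed.

Lemma gpath_size p e : gpath p e -> (size p <= #|X|)%N.
Proof.
by move=> /gpath_uniq /card_uniqP; rewrite size_map => <-; apply: max_card.
Qed.

Definition path_weight p e : F :=
  \prod_(i < size p)
    - (kappa (path_t p e i) (path_s p e i.+1) /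
       kappa (path_t p e i) (path_s p e i)).

Lemma path_weight_cons s t p e :
  path_weight ((s, t) :: p) e =
  - (kappa t (path_s p e 0) / kappa t s) * path_weight p e.
Proof. by rewrite /path_weight big_ord_recl. Qed.

Definition path_sumk k x y : F :=
  \sum_(p : k.-tuple (X * X) | gpath p y && (path_s p y 0 == x)) path_weight p y.

Definition path_sum x y : F :=
  \sum_(p : {bseq #|X| of X * X} | gpath p y && (path_s p y 0 == x)) path_weight p y.

(* The entries of minus the off-diagonal part of the block of the boundary from
   targets to sources, after rescaling the targets; [path_sum] is the Neumann
   series of its powers, finite because the field is gradient. *)
Definition step x y : F :=
  \sum_(t | (x, t) \in V) if y != x then - (kappa t y / kappa t x) else 0.

Lemma path_sumk0 x y : path_sumk 0 x y = (x == y)%:R.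
Proof.
rewrite /path_sumk (big_tuple0 (fun p => path_weight p y)
  (fun p => gpath p y && (path_s p y 0 == x))) /= /path_weight big_ord0 eq_sym.
by case: eqP.
Qed.

(** Splitting off the first pair of a path; so [path_sumk k] is the k-th power of the matrix
    [step]. *)
Lemma path_sumkS k x y : path_sumk k.+1 x y = \sum_z step x z * path_sumk k z y.
Proof.
rewrite /path_sumk (big_tupleS _ (fun p => path_weight p y)
  (fun p => gpath p y && (path_s p y 0 == x))).
transitivity (\sum_z \sum_t \sum_(p : k.-tuple (X * X) |
    gpath p y && (path_s p y 0 == z))
    (if ((x, t) \in V) && (z != x) then - (kappa t z / kappa t x) else 0) *
    path_weight p y).
  rewrite [RHS]exchange_big /=.
  transitivity (\sum_s \sum_t \sum_(p : k.-tuple (X * X) |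
    gpath ((s, t) :: p) y && (path_s ((s, t) :: p) y 0 == x)) path_weight ((s, t) :: p) y).
    by rewrite pair_bigA; apply: eq_bigr => -[s t].
  rewrite (bigD1 x) //= [X in _ + X]big1 ?addr0 => [|s sx]; last first.
    rewrite big1 // => t _; rewrite big_pred0 // => p.
    by rewrite /path_s /= (negPf sx) andbF.
  apply: eq_bigr => t _.
  rewrite (exchange_big_dep (fun p : k.-tuple (X * X) => gpath p y)) /=; last by move=> z p _ /andP[].
  rewrite big_mkcond [RHS]big_mkcond; apply: eq_bigr => p _.
  case: (boolP (gpath p y)) => gp; last by rewrite !andbF.
  rewrite (big_pred1 (path_s p y 0)) => [|z]; last by rewrite /= eq_sym.
  rewrite path_weight_cons /path_s /= eqxx !andbT.
  case: ((x, t) \in V) => //=; last by rewrite mul0r.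
  (* The facet condition is absent from [step], whose term vanishes anyway when the incidence is
     0. *)
  rewrite /facet; case: (_ =P 0) => [->|_] /=; last by case: ifP => //; rewrite mul0r.
  by rewrite mul0r oppr0 if_same mul0r.
apply: eq_bigr => z _; rewrite /step [in RHS]big_mkcond mulr_suml; apply: eq_bigr => t _.
rewrite -mulr_sumr; congr (_ * _).
by case: (_ \in V) => //=; rewrite if_same.
Qed.

(** The Neumann series identity P = 1 + step P: the power of exponent [#|X|.+1] vanishes, as no path
    is that long. *)
Lemma path_sumE x y : path_sum x y = (x == y)%:R + \sum_z step x z * path_sum z y.
Proof.
have e z : path_sum z y = \sum_(k < #|X|.+1) path_sumk k z y.
  exact: (big_bseq _ (fun p => path_weight p y) (fun p => gpath p y && (path_s p y 0 == z))).
have last0 z : path_sumk #|X|.+1 z y = 0.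
  rewrite /path_sumk big_pred0 // => p; apply/negP => /andP[/gpath_size].
  by rewrite size_tuple ltnn.
rewrite e big_ord_recl path_sumk0; congr (_ + _).
transitivity (\sum_(k < #|X|.+1) path_sumk k.+1 x y).
  by rewrite big_ord_recr /= last0 addr0.
under eq_bigr do rewrite path_sumkS.
by rewrite exchange_big; apply: eq_bigr => z _; rewrite -mulr_sumr e.
Qed.

Lemma path_sum_dim x y : path_sum x y != 0 -> cdim x = cdim y.
Proof.
apply: contraNeq => xy; rewrite /path_sum big_pred0 // => p.
apply: contraNF xy => /andP[gp /eqP <-].
have : all (mem V) p by case: p gp => p pX /=; elim: p {pX} => //= st p IH /and4P[-> _ _ /IH].
elim: {p}(val p) gp => //= -[s t] p IH /and4P[st /kappa_dim ty _ /IH].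
by move=> /[swap] /andP[_ pV] /(_ pV) /eqP <-; have /kappa_dim := hV.1.1 _ st;
  rewrite /= ty => -[->].
Qed.

(** The empty path gives [kappa t s], the others the sum in [kappa_morse]; if the dimensions do not
    fit, every product vanishes. *)
Lemma kappa_morseE t s : kappa_morse V t s = \sum_x kappa t x * path_sum x s.
Proof.
rewrite /kappa_morse; case: eqP => [_|ts]; last first.
  rewrite big1 // => x _; have [->|/kappa_dim tx] := eqVneq (kappa t x) 0.
    by rewrite mul0r.
  have [->|/path_sum_dim xs] := eqVneq (path_sum x s) 0; first by rewrite mulr0.
  by rewrite tx xs in ts.
have -> : \sum_x kappa t x * path_sum x s =
    \sum_(p : {bseq #|X| of X * X} | gpath p s)
      kappa t (path_s p s 0) * path_weight p s.
  under eq_bigr do rewrite mulr_sumr.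
  rewrite (exchange_big_dep (fun p : {bseq #|X| of X * X} => gpath p s)) /=; last by move=> x p _ /andP[].
  apply: eq_bigr => p gp; rewrite gp /=.
  by rewrite (big_pred1 (path_s p s 0)) // => z; rewrite /= eq_sym.
rewrite [RHS](bigD1 [bseq]) //= /path_weight big_ord0 mulr1; congr (_ + _).
rewrite big_mkcond [RHS]big_mkcond; apply: eq_bigr => p _.
rewrite gradient_pathE.
have -> : (p != [bseq]) = (0 < size p)%N by case: p => -[].
case: (0 < size p)%N => /=; last by rewrite andbF.
rewrite andbT; case: gpath => //=; rewrite /facet.
by case: eqP => //= ->; rewrite mul0r.
Qed.

End GradientPaths.

(** * The Morse complex *)

Section MatrixOperators.
Variables (F : fieldType) (K L : gradedCells F).

Definition mxop_fun (a : K -> L -> F) (c : chain K) : chain L :=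
  [ffun y => \sum_x (c x : F) * a x y].

Fact mxop_linear a : linear (mxop_fun a).
Proof.
move=> k c d; apply/ffunP => s; rewrite !ffunE scaler_sumr -big_split.
by apply: eq_bigr => t _; rewrite !ffunE mulrDl scalerAl.
Qed.
HB.instance Definition _ a :=
  GRing.isLinear.Build F (chain K) (chain L) *:%R (mxop_fun a) (mxop_linear a).

Definition mxop a : 'Hom(chain K, chain L) := linfun (mxop_fun a).

Lemma mxopE a c y : mxop a c y = \sum_x (c x : F) * a x y.
Proof. by rewrite lfunE ffunE. Qed.

Lemma mxop_Cq a q q' (A : {set K}) (B : {set L}) c :
  (forall x y, a x y != 0 -> x \in A -> cdim x = q ->
    (y \in B) && (cdim y == q')) ->
  c \in Cq q A -> mxop a c \in Cq q' B.
Proof.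
move=> aP /mem_Cq cA; apply/mem_Cq => y; rewrite mxopE; apply: contraNT => yB.
rewrite big1 // => x _; have [->|/cA/andP[xA /eqP xq]] := eqVneq (c x) 0.
  by rewrite mul0r.
have [->|axy] := eqVneq (a x y) 0; first by rewrite mulr0.
by rewrite (aP x y axy xA xq) in yB.
Qed.

End MatrixOperators.

Lemma mem_Cq0 (F : fieldType) (K : gradedCells F) (A : {set K}) :
  A = set0 -> forall q, Cq q A = 0%VS.
Proof.
move=> -> q; apply/eqP; rewrite -subv0; apply/subvP => c /mem_Cq cA.
rewrite memv0; apply/eqP/ffunP => s; rewrite ffunE.
by apply/eqP/negPn/negP => /cA; rewrite inE.
Qed.

Section MorseEquivalence.
Variables (F : fieldType) (X : cellComplex F) (V : {set X * X}).
Hypothesis hV : discrete_gradient_vector_field V.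
Implicit Types (s t x y : X) (c : chain X) (m : chain (morse V)).

Local Notation bd := (boundary X).
Local Notation bdM := (boundary (morse V)).

Lemma boundary2 c : bd (bd c) = 0.
Proof.
apply/ffunP => s; rewrite boundaryE ffunE.
under eq_bigr do rewrite boundaryE mulr_suml.
rewrite exchange_big big1 // => t _.
under eq_bigr do rewrite -mulrA.
by rewrite -mulr_sumr kappa_kappa mulr0.
Qed.

Definition source s := [exists t, (s, t) \in V].
Definition target t := [exists s, (s, t) \in V].

Lemma criticalE s : critical V s = ~~ source s && ~~ target s.
Proof.
apply/forallP/andP => [h|[sN tN] [x y]].
  by split; apply/existsP => -[t st]; have := h (s, t); have := h (t, s);
     rewrite st /= eqxx ?andbF.
apply/implyP => xy; apply/andP; split; apply/eqP => e; rewrite e /= in sN tN.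
  by case/existsP: sN; exists y.
by case/existsP: tN; exists x.
Qed.

Lemma matched_kappa s t : (s, t) \in V -> kappa t s != 0.
Proof. by move=> st; have := hV.1.1 _ st. Qed.

Lemma matched_dim s t : (s, t) \in V -> cdim t = (cdim s).+1.
Proof. by move=> st; apply/kappa_dim/matched_kappa. Qed.

Lemma target_inj s s' t : (s, t) \in V -> (s', t) \in V -> s = s'.
Proof. by move=> st st'; have [_ /(_ erefl) [->]] := hV.1.2 _ _ st st'. Qed.

Lemma source_inj s t t' : (s, t) \in V -> (s, t') \in V -> t = t'.
Proof. by move=> st st'; have [/(_ erefl) [->]] := hV.1.2 _ _ st st'. Qed.

Definition stepop : 'End(chain X) := mxop (step V).
Definition pathop : 'End(chain X) := mxop (path_sum V).
Definition pairop : 'End(chain X) :=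
  mxop (fun s t => if (s, t) \in V then (kappa t s)^-1 else 0).

Lemma path_step c : pathop (stepop c) = pathop c - c.
Proof.
apply/ffunP => y; rewrite !ffunE !mxopE.
under eq_bigr do rewrite mxopE mulr_suml.
have -> : \sum_x (c x : F) * path_sum V x y =
    c y + \sum_x \sum_z (c x : F) * (step V x z * path_sum V z y).
  under eq_bigr do rewrite path_sumE // mulrDr mulr_sumr.
  rewrite big_split /=; congr (_ + _); rewrite (bigD1 y) //= eqxx mulr1.
  by rewrite big1 ?addr0 // => x /negPf ->; rewrite mulr0.
rewrite addrAC subrr add0r exchange_big; apply: eq_bigr => x _ /=.
by apply: eq_bigr => z _; rewrite mulrA.
Qed.

(* [pathop] is a left inverse, hence a two-sided inverse, of [1 - stepop]. *)
Lemma step_path c : stepop (pathop c) = pathop c - c.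
Proof.
pose f : 'End(chain X) := (\1 - stepop)%VF.
have pf (x : chain X) : pathop (f x) = x.
  by rewrite add_lfunE opp_lfunE id_lfunE linearB /= path_step subKr.
have kf : lker f == 0%VS.
  by apply/lker0P => x y e; rewrite -(pf x) e pf.
have fp (x : chain X) : f (pathop x) = x.
  have /memv_imgP[y _ ->] : x \in limg f by rewrite lker0_limgf ?memvf.
  by rewrite pf.
apply/eqP; rewrite eq_sym subr_eq addrC -subr_eq; apply/eqP.
by have := fp c; rewrite add_lfunE opp_lfunE id_lfunE.
Qed.

(** Scaled by the inverse incidence, a target has coefficient 1 on its own source, and its other
    faces give the entries of [step] with the opposite sign. *)
Lemma boundary_pair c s :
  bd (pairop c) s = (if source s then c s else 0) - stepop c s.
Proof.
rewrite boundaryE mxopE; under eq_bigr do rewrite mxopE mulr_suml.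
rewrite exchange_big /=.
have e x : \sum_t c x * (if (x, t) \in V then (kappa t x)^-1 else 0) * kappa t s =
    (if (x == s) && source s then c x else 0) - c x * step V x s.
  rewrite /step mulr_sumr [X in _ - X]big_mkcond -sumrN.
  case: (eqVneq x s) => [->|xs] /=.
    case: (boolP (source s)) => [/existsP[t st]|sN].
      rewrite (bigD1 t) //= st -mulrA mulVf ?matched_kappa // mulr1.
      rewrite !big1 ?subr0 ?addr0 // => t'; rewrite ?eqxx ?mulr0 ?if_same ?oppr0 //.
      move=> tt'; case: ifP => [st'|_]; last by rewrite mulr0 mul0r.
      by rewrite (source_inj st st') eqxx in tt'.
    rewrite !big1 ?addr0 // => t _; rewrite ?eqxx ?mulr0 ?if_same ?oppr0 //.
    case: ifP => [st|_]; last by rewrite mulr0 mul0r.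
    by case/existsP: sN; exists t.
  rewrite add0r; apply: eq_bigr => t _.
  case: ifP => _; rewrite ?mulr0 ?mul0r ?oppr0 //.
  by rewrite mulrN opprK -mulrA (mulrC (_^-1)).
under eq_bigr do rewrite e.
rewrite sumrB; congr (_ - _).
case: (boolP (source s)) => ss; last by rewrite big1 // => x _; rewrite andbF.
by rewrite -big_mkcond (big_pred1 s) // => x; rewrite andbT.
Qed.

Lemma pair_target c t : ~~ target t -> pairop c t = 0.
Proof.
move=> tN; rewrite mxopE big1 // => x _; case: ifP => xt; rewrite ?mulr0 //.
by case/existsP: tN; exists x.
Qed.

(* The inverse of the block of the boundary from targets to sources, extended
   by zero. *)
Definition hop c : chain X := pairop (pathop c).

Lemma hop_linear : linear hop.
Proof. by move=> a x y; rewrite /hop !linearP. Qed.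
HB.instance Definition _ :=
  GRing.isLinear.Build F (chain X) (chain X) *:%R hop hop_linear.

Lemma hop_target c t : ~~ target t -> hop c t = 0.
Proof. exact: pair_target. Qed.

Lemma boundary_hop c s : source s -> bd (hop c) s = c s.
Proof. by move=> ss; rewrite boundary_pair ss step_path !ffunE subKr. Qed.

Lemma boundary_hop_critical c s : ~~ source s -> pathop c s = c s - bd (hop c) s.
Proof.
by move=> /negPf ss; rewrite boundary_pair ss step_path !ffunE sub0r opprK addrC subrK.
Qed.

(** A chain on targets is [pairop d] with [d] on sources; its boundary is (1 - step) d, and [pathop]
    inverts 1 - step. *)
Lemma hop_boundary c : (forall s, ~~ target s -> c s = 0) -> hop (bd c) = c.
Proof.
move=> cT; pose d : chain X := [ffun s => \sum_(t | (s, t) \in V) kappa t s * c t].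
have dS s : ~~ source s -> d s = 0.
  move=> sN; rewrite ffunE big_pred0 // => t; apply: contraNF sN => st.
  by apply/existsP; exists t.
have -> : c = pairop d.
  apply/ffunP => t; case: (boolP (target t)) => [/existsP[s st]|tN]; last first.
    by rewrite cT // pair_target.
  rewrite mxopE (bigD1 s) //= st big1 => [|x xs]; last first.
    case: ifP => xt; last by rewrite mulr0.
    by rewrite (target_inj xt st) eqxx in xs.
  rewrite ffunE (big_pred1 t) => [|t']; last first.
    by apply/idP/eqP => [/(source_inj st)|->].
  by rewrite addr0 mulrAC mulfV ?matched_kappa // mul1r.
have -> : bd (pairop d) = d - stepop d.
  apply/ffunP => s; rewrite boundary_pair !ffunE; congr (_ - _).
  by case: ifP => // /negbT /dS; rewrite ffunE => ->.
by rewrite /hop linearB /= path_step subKr.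
Qed.

Lemma hop_boundary_hop c : hop (bd (hop c)) = hop c.
Proof. by apply: hop_boundary => t; apply: hop_target. Qed.

Definition mproj c : chain (morse V) := [ffun k => pathop c (val k)].
Definition mincl m : chain X :=
  [ffun s => if insub s is Some k then m (k : {c : X | critical V c}) else 0].
(** The correction clears the source coefficients from the boundary of [mincl m], which makes [minj]
    a chain map. *)
Definition minj m : chain X := mincl m - hop (bd (mincl m)).

Fact mproj_linear : linear mproj.
Proof. by move=> a x y; apply/ffunP => k; rewrite !ffunE linearP !ffunE. Qed.
HB.instance Definition _ :=
  GRing.isLinear.Build F (chain X) (chain (morse V)) *:%R mproj mproj_linear.

Fact mincl_linear : linear mincl.
Proof.
move=> a x y; apply/ffunP => s; rewrite !ffunE; case: insubP => [k _ _|_].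
  by rewrite !ffunE.
by rewrite scaler0 addr0.
Qed.
HB.instance Definition _ :=
  GRing.isLinear.Build F (chain (morse V)) (chain X) *:%R mincl mincl_linear.

Fact minj_linear : linear minj.
Proof.
by move=> a x y; rewrite /minj !linearP scalerDr addrACA.
Qed.
HB.instance Definition _ :=
  GRing.isLinear.Build F (chain (morse V)) (chain X) *:%R minj minj_linear.

Lemma mincl_mproj c s :
  mincl (mproj c) s = if critical V s then pathop c s else 0.
Proof.
rewrite ffunE; case: insubP => [k -> <-|/negPf -> //].
by rewrite ffunE.
Qed.

Lemma mproj_boundary_target c :
  (forall s, ~~ target s -> c s = 0) -> mproj (bd c) = 0.
Proof.
move=> cT; apply/ffunP => k; rewrite !ffunE.
have := valP k; rewrite criticalE => /andP[kN _].
by rewrite boundary_hop_critical // hop_boundary // subrr.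
Qed.

(** By [kappa_morseE], the Morse boundary is the product of [kappa] and [path_sum], restricted to
    critical cells. *)
Lemma mproj_boundary2 m : bdM m = mproj (bd (mincl m)).
Proof.
apply/ffunP => s; rewrite ffunE boundaryE mxopE.
under [RHS]eq_bigr do rewrite boundaryE mulr_suml.
rewrite [RHS]exchange_big /=.
have -> : \sum_(t : X) \sum_(x : X) (mincl m t : F) * kappa t x * path_sum V x (val s) =
    \sum_(t : X | critical V t) (mincl m t : F) * kappa_morse V t (val s).
  rewrite [RHS]big_mkcond; apply: eq_bigr => t _; rewrite kappa_morseE // mulr_sumr.
  case: ifP => ct; last by rewrite big1 // => x _; rewrite ffunE insubF // !mul0r.
  by apply: eq_bigr => x _; rewrite mulrA.
rewrite (reindex_omap (val : morse V -> X) insub) => [|t ct]; last by rewrite insubT.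
apply: eq_big => [k|k _]; first by rewrite valK (valP k) eqxx.
by rewrite ffunE valK.
Qed.

(* The projection homotopic to the identity through [hop]; its image is a copy
   of the chains of the Morse complex. *)
Definition hproj c : chain X := c - bd (hop c) - hop (bd c).

(** On sources both chains vanish, and on critical cells both are given by [pathop]; so they differ
    by a chain on targets. *)
Lemma mincl_mproj_target c s :
  ~~ target s -> (hproj c - mincl (mproj c)) s = 0.
Proof.
move=> sN; rewrite !ffunE (hop_target _ sN) -[_ - 0]/(_ + - 0) oppr0 addr0.
have := mincl_mproj c s; rewrite ffunE => ->; rewrite criticalE sN andbT.
case: (boolP (source s)) => ss /=; first by rewrite boundary_hop // subrr subr0.
by rewrite boundary_hop_critical // subrr.
Qed.

Lemma hop_hproj c : hop (bd (hproj c)) = 0.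
Proof.
by rewrite /hproj !linearB /= boundary2 linear0 subr0 hop_boundary_hop subrr.
Qed.

(** The correction in [minj] restores the difference [e]: the map hop bd fixes [e], a chain on
    targets, and kills [hproj c]. *)
Lemma minj_mproj c : minj (mproj c) = hproj c.
Proof.
set e := hproj c - mincl (mproj c).
have eT : hop (bd e) = e by apply: hop_boundary => s; apply: mincl_mproj_target.
have me : mincl (mproj c) = hproj c - e by rewrite /e subKr.
move: e eT me => e eT me.
rewrite /minj me; move: (hproj c) (hop_hproj c) eT => h hh eT.
have -> : hop (bd (h - e)) = - e by rewrite !linearB /= hh eT sub0r.
by rewrite opprK subrK.
Qed.

(** Up to boundaries and chains on targets, [mincl (mproj c)] is [c], and [mproj] after the boundary
    kills both. *)
Lemma boundary_mproj c : bdM (mproj c) = mproj (bd c).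
Proof.
set e := hproj c - mincl (mproj c).
have eT : mproj (bd e) = 0.
  by apply: mproj_boundary_target => s; apply: mincl_mproj_target.
have me : mincl (mproj c) = hproj c - e by rewrite /e subKr.
move: e eT me => e eT me.
rewrite mproj_boundary2 me.
have -> : mproj (bd (hproj c - e)) = mproj (bd (hproj c)).
  by move: (hproj c) => h; rewrite !linearB /= eT subr0.
rewrite /hproj !linearB /= boundary2 linear0 subr0.
rewrite (mproj_boundary_target (c := hop (bd c))) ?subr0 // => s.
exact: hop_target.
Qed.

(** Both sides equal [hproj] of the boundary of [mincl m]. *)
Lemma boundary_minj m : bd (minj m) = minj (bdM m).
Proof.
rewrite mproj_boundary2 minj_mproj /hproj boundary2 linear0 subr0.
by rewrite /minj linearB.
Qed.

Lemma boundaryM2 m : bdM (bdM m) = 0.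
Proof. by rewrite [bdM m]mproj_boundary2 boundary_mproj boundary2 linear0. Qed.

(** * Restriction to a subcomplex that respects the matching *)

Section Support.
Variable A : {set X}.
Hypotheses (A_sub : is_subcomplex A)
  (A_match : forall p, p \in V -> (p.1 \in A <-> p.2 \in A)).

Let AM : {set morse V} := [set k | val k \in A].

Lemma facet_closed s t : kappa t s != 0 -> t \in A -> s \in A.
Proof. by move=> st; apply: A_sub; apply: connect1. Qed.

Lemma path_sum_closed x y : path_sum V x y != 0 -> x \in A -> y \in A.
Proof.
move=> xy xA; apply: contraNT xy => yA; rewrite /path_sum big_pred0 // => p.
apply: contraNF yA => /andP[gp /eqP px]; rewrite -{}px in xA.
elim: {p}(val p) gp xA => //= -[s t] p IH /and4P[st /facet_closed ty _ gp] sA.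
by apply: IH => //; apply: ty; apply/(A_match st).
Qed.

Lemma pathop_Cq q c : c \in Cq q A -> pathop c \in Cq q A.
Proof.
apply: mxop_Cq => x y xy xA <-.
by rewrite (path_sum_closed xy xA) (path_sum_dim hV xy) eqxx.
Qed.

Lemma hop_Cq q c : c \in Cq q A -> hop c \in Cq q.+1 A.
Proof.
move=> /pathop_Cq; apply: mxop_Cq => x t; case: ifP => [xt _ xA <-|]; last by rewrite eqxx.
by rewrite (matched_dim xt) eqxx andbT; apply/(A_match xt).
Qed.

Lemma boundary_Cq q c : c \in Cq q.+1 A -> bd c \in Cq q A.
Proof.
apply: (@mxop_Cq _ X X) => t s ts tA tq.
by rewrite (facet_closed ts tA) -eqSS -(kappa_dim ts) tq eqxx.
Qed.

Lemma boundary_Cq0 c : c \in Cq 0 A -> bd c = 0.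
Proof.
move=> /mem_Cq c0; apply/ffunP => s; rewrite boundaryE ffunE big1 // => t _.
have [->|/c0 /andP[_ /eqP t0]] := eqVneq (c t) 0; first by rewrite mul0r.
have [->|/kappa_dim] := eqVneq (kappa t s) 0; first by rewrite mulr0.
by rewrite t0.
Qed.

Lemma mproj_Cq q c : c \in Cq q A -> mproj c \in Cq q AM.
Proof.
move=> /pathop_Cq/mem_Cq cA; apply/mem_Cq => k; rewrite ffunE => /cA.
by rewrite inE.
Qed.

Lemma mincl_Cq q m : m \in Cq q AM -> mincl m \in Cq q A.
Proof.
move=> /mem_Cq mA; apply/mem_Cq => s; rewrite ffunE.
case: insubP => [k _ <-|_]; last by rewrite eqxx.
by move/mA; rewrite inE.
Qed.

Lemma minj_Cq q m : m \in Cq q AM -> minj m \in Cq q A.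
Proof.
move=> /mincl_Cq mA; rewrite /minj rpredB //; case: q => [|q] in mA *.
  by rewrite (boundary_Cq0 mA) linear0 mem0v.
by apply/hop_Cq/boundary_Cq.
Qed.

Lemma mproj_Zq q c : c \in Zq q A -> mproj c \in Zq q AM.
Proof.
rewrite !memv_cap !memv_ker => /andP[/mproj_Cq -> /eqP c0].
by rewrite boundary_mproj c0 linear0 eqxx.
Qed.

Lemma minj_Zq q m : m \in Zq q AM -> minj m \in Zq q A.
Proof.
rewrite !memv_cap !memv_ker => /andP[/minj_Cq -> /eqP c0].
by rewrite boundary_minj c0 linear0 eqxx.
Qed.

Lemma mproj_Bq q c : c \in Bq q A -> mproj c \in Bq q AM.
Proof.
case/memv_imgP => d /mproj_Cq dA ->.
by rewrite -boundary_mproj memv_img.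
Qed.

Lemma minj_Bq q m : m \in Bq q AM -> minj m \in Bq q A.
Proof.
case/memv_imgP => d /minj_Cq dA ->.
by rewrite -boundary_minj memv_img.
Qed.

(** On a cycle the homotopy leaves only the boundary of [hop c], and [hop] preserves the
    subcomplex. *)
Lemma minj_mproj_Bq q c : c \in Zq q A -> c - minj (mproj c) \in Bq q A.
Proof.
rewrite memv_cap memv_ker => /andP[cA /eqP c0].
rewrite minj_mproj /hproj c0 linear0 subr0 subKr.
by apply/memv_img/hop_Cq.
Qed.

Lemma BqM_Zq q : (Bq q AM <= Zq q AM)%VS.
Proof.
apply/subvP => _ /memv_imgP[m mA ->]; rewrite memv_cap memv_ker boundaryM2 eqxx andbT.
rewrite mproj_boundary2; apply/mproj_Cq/boundary_Cq/mincl_Cq.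
exact: mA.
Qed.

End Support.
End MorseEquivalence.

(** * From the Morse complex to the homology module *)

Lemma eq_sub_exact (F : fieldType) n (E : vectType F)
    (U U' : {set 'I_n} -> {vspace E}) i :
  U =1 U' -> sub_exact U i -> sub_exact U' i.
Proof.
move=> UU' ex z zU dz; have [A|//|z' z'U ez'] := ex z; first by rewrite UU'.
by exists z' => // A; rewrite -UU'.
Qed.

(** In top degree the only component is at the full set, and the boundary at the complement of one
    index is that component up to sign, so cycles vanish. *)
Lemma sub_exact_top (F : fieldType) n (E : vectType F)
    (U : {set 'I_n} -> {vspace E}) i : (0 < n)%N -> i = n -> sub_exact U i.
Proof.
move=> n0 -> z _ dz; exists (fun=> 0) => [A|A An]; first exact: mem0v.
have -> : A = setT by apply/eqP; rewrite eqEcard subsetT cardsT card_ord An leqnn.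
pose k := Ordinal n0; have := dz (setT :\ k).
rewrite -[X in _ = X]card_ord -cardsT [X in _ = X](cardsD1 k) inE => /(_ erefl).
rewrite /kd [in X in X -> _](big_pred1 k) => [/eqP|j]; last by rewrite !inE andbT negbK.
rewrite setD1K ?inE // scaler_eq0 /ksign signr_eq0 => /eqP ->.
by rewrite big1 // => j _; rewrite scaler0.
Qed.

Section Transfer.
Variables (n : nat) (F : fieldType) (X : cellComplex F) (Xf : filtration n X).
Variables (V : {set X * X}).
Hypotheses (hV : discrete_gradient_vector_field V) (hcons : consistent V Xf).
Implicit Types (u : grade n) (A : {set 'I_n}).

Definition morse_at u A : {set morse V} := at_sub (morse_fam V Xf) u (eset A).

Lemma morse_atE u A : gle (eset A) u -> morse_at u A = morse_fam V Xf (kdeg u A).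
Proof. by rewrite /morse_at /at_sub => ->. Qed.

Lemma morse_atN u A : ~~ gle (eset A) u -> morse_at u A = set0.
Proof. by rewrite /morse_at /at_sub => /negPf ->. Qed.

Let Xsub u : is_subcomplex (Xf u) := fam_subcomplex (f := Xf) (u := u).
Let Xmatch u : forall p, p \in V -> (p.1 \in Xf u <-> p.2 \in Xf u) :=
  fun p => @hcons p u.

Lemma Bq_Zq_morse_at q u A : (Bq q (morse_at u A) <= Zq q (morse_at u A))%VS.
Proof.
case: (boolP (gle (eset A) u)) => Au; last by rewrite /Bq mem_Cq0 ?morse_atN // limg0 sub0v.
by rewrite morse_atE //; apply: (BqM_Zq hV (@Xsub _) (@Xmatch _)).
Qed.

Lemma qproj_eq (vT : vectType F) (Z B : {vspace vT}) x y :
  x \in Z -> y \in Z -> x - y \in B -> qproj Z B x = qproj Z B y.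
Proof.
move=> xZ yZ xy; apply/eqP; rewrite -subr_eq0 -linearB /=.
by rewrite qproj_eq0 // rpredB.
Qed.

Lemma hom_mul_qproj q u v w : gle u v -> w \in Zq q (Xf u) ->
  gmul (Vmod Xf q) u v (qproj (Zq q (Xf u)) (Bq q (Xf u)) w) =
  qproj (Zq q (Xf v)) (Bq q (Xf v)) w.
Proof.
move=> uv wZ; rewrite [LHS]hom_mulE.
have ZS := subvP (ZqS q (fam_mono Xf uv)); have BS := subvP (BqS q (fam_mono Xf uv)).
apply: qproj_eq; rewrite ?ZS ?qrepr_in //.
by rewrite BS ?qproj_repr_sub.
Qed.

(** Representatives of the classes are projected to Morse cycles by [mproj], the problem is solved
    there, and the solution is carried back by [minj]. *)
Lemma koszul_exact_Vmod q u i :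
  pair_exact (fun A => Zq q (morse_at u A)) (fun A => Bq q (morse_at u A)) i ->
  koszul_exact (Vmod Xf q) u i.
Proof.
move=> ex v dv.
pose r A : chain X := qrepr (Zq q (Xf (kdeg u A))) (Bq q (Xf (kdeg u A))) (v A).
pose z A := if gle (eset A) u then mproj V (r A) else 0.
have rZ A : r A \in Zq q (Xf (kdeg u A)) by apply: qrepr_in.
have rZk A k : r (k |: A) \in Zq q (Xf (kdeg u A)).
  by apply: (subvP (ZqS q (fam_mono Xf _))) (rZ _); rewrite kdegS ?subsetUr.
pose dr A := \sum_(k | (k \notin A) && gle (eset (k |: A)) u) ksign F k A *: r (k |: A).
have kdz A : kd z A = mproj V (dr A).
  rewrite linear_sum /kd big_mkcondr; apply: eq_bigr => k kA.
  by rewrite /z; case: ifP => _; rewrite ?scaler0 // linearZ.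
have drZ A : dr A \in Zq q (Xf (kdeg u A)).
  by apply: memv_suml => k _; rewrite memvZ.
have drE A : kdm v A = qproj _ _ (dr A).
  rewrite linear_sum; apply: eq_bigr => k _; rewrite linearZ; congr (_ *: _).
  by rewrite -[v (k |: A)]qreprK hom_mul_qproj ?kdegS ?subsetUr // qrepr_in.
have [A|A Ai|z' z'Z ez'] := ex z.
- rewrite /z; case: ifP => Au; last exact: mem0v.
  by rewrite morse_atE //; apply: (mproj_Zq hV (@Xsub _) (@Xmatch _)).
- case: (boolP (gle (eset A) u)) => Au; last first.
    rewrite /kd big1 ?mem0v // => k _; rewrite /z ifN ?scaler0 //.
    by apply: contra Au; apply: gle_esetW; apply: subsetUr.
  rewrite kdz morse_atE //; apply: (mproj_Bq hV (@Xsub _) (@Xmatch _)).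
  by rewrite -(qproj_eq0 _ (drZ A)) -drE dv.
have z'N A : ~~ gle (eset A) u -> z' A = 0.
  move=> Au; apply/eqP; rewrite -memv0 -(mem_Cq0 (morse_atN Au) q).
  by have := z'Z A; rewrite memv_cap => /andP[].
have z'X A : gle (eset A) u -> minj (z' A) \in Zq q (Xf (kdeg u A)).
  move=> Au; apply: (minj_Zq hV (@Xsub _) (@Xmatch _)).
  by have := z'Z A; rewrite morse_atE.
exists (fun A => qproj _ _ (minj (z' A))) => A Au Ai.
have kz'X k : minj (z' (k |: A)) \in Zq q (Xf (kdeg u A)).
  have [ku|/z'N ->] := boolP (gle (eset (k |: A)) u); last by rewrite linear0 mem0v.
  by apply: (subvP (ZqS q (fam_mono Xf _))) (z'X _ ku); rewrite kdegS ?subsetUr.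
have -> : kdm (fun A => qproj (Zq q (Xf (kdeg u A))) (Bq q (Xf (kdeg u A))) (minj (z' A))
     : Vmod Xf q (kdeg u A)) A =
    qproj (Zq q (Xf (kdeg u A))) (Bq q (Xf (kdeg u A))) (minj (kd z' A)).
  rewrite !linear_sum /kdm big_mkcondr; apply: eq_bigr => k kA.
  case: ifP => ku; last by rewrite z'N ?ku // scaler0 !linear0.
  by rewrite !linearZ /= hom_mul_qproj ?kdegS ?subsetUr ?z'X.
rewrite -[v A]qreprK; apply: qproj_eq; rewrite ?qrepr_in //.
  by rewrite linear_sum; apply: memv_suml => k _; rewrite linearZ memvZ /=.
rewrite -opprB rpredN -/(r A).
(* The first summand is the homotopy error, a boundary in X; the second is the image of a Morse
   boundary. *)
have -> : r A - minj (kd z' A) = (r A - minj (mproj V (r A))) + minj (z A - kd z' A).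
  by rewrite /z Au [minj (mproj _ _ - _)]linearB /= addrA subrK.
rewrite rpredD //; first exact: (minj_mproj_Bq hV (@Xsub _) (@Xmatch _)).
apply: (minj_Bq hV (@Xsub _) (@Xmatch _)).
by have := ez' A Ai; rewrite morse_atE.
Qed.

Lemma xi_eq0 q i u :
  pair_exact (fun A => Zq q (morse_at u A)) (fun A => Bq q (morse_at u A)) i ->
  xi Xf q i u = 0%N.
Proof. by move=> /koszul_exact_Vmod; apply: betti_eq0_koszul. Qed.

Lemma xiS_eq0 q i u :
  sub_exact (fun A => Zq q (morse_at u A)) i.+1 ->
  sub_exact (fun A => Bq q (morse_at u A)) i -> xi Xf q i.+1 u = 0%N.
Proof.
move=> exZ exB; apply: xi_eq0; apply: pair_exactS => // A; exact: Bq_Zq_morse_at.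
Qed.

End Transfer.

(** * One-critical filtrations: entrance grades and exactness criteria *)

Section OneCritical.
Variables (n : nat) (F : fieldType) (X : cellComplex F) (Xf : filtration n X).
Variables (V : {set X * X}) (h : X -> grade n).
Hypothesis hX : forall u, Xf u = [set s | gle (h s) u].
Implicit Types (u : grade n) (A : {set 'I_n}) (q : nat).

Lemma at_sub_morse u a :
  at_sub (morse_fam V Xf) u a = [set c | gle (gadd (h (val c)) a) u].
Proof.
apply/setP => c; rewrite /at_sub; case: ifP => au; rewrite !inE.
  by rewrite hX inE gle_gadd.
apply/esym/negbTE/negP => /gleP ca; case/negP: (negbT au); apply/gleP => i.
by have := ca i; rewrite ffunE; apply: leq_trans; apply: leq_addl.
Qed.

Lemma morse_at0 u : morse_at Xf V u set0 = morse_fam V Xf u.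
Proof. by rewrite morse_atE ?eset0_le // kdeg0. Qed.

Lemma morse_at1 u j : morse_at Xf V u [set j] = at_sub (morse_fam V Xf) u (gunit j).
Proof. by rewrite /morse_at eset1. Qed.

Lemma entrance_gradeE s : entrance_grade Xf s (h s).
Proof.
split=> [|j]; first by rewrite hX inE gle_refl.
rewrite /at_sub; case: ifP => [/gleP/(_ j)|_]; last by rewrite inE.
rewrite hX inE ffunE eqxx => hj; apply/negP => /gleP/(_ j).
by rewrite !ffunE eqxx leqNgt ltn_subrL hj.
Qed.

Definition slack q j u : Prop :=
  forall c, critical V c -> cdim c = q -> gle (h c) u -> (h c j < u j)%N.

Lemma Cq_slack q j u A : slack q j u -> j \in A ->
  (Cq q (morse_at Xf V u (A :\ j)) <= Cq q (morse_at Xf V u A))%VS.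
Proof.
move=> sl jA; apply/subvP => c /mem_Cq cA; apply/mem_Cq => k /cA.
rewrite /morse_at !at_sub_morse !inE => /andP[kA kq]; rewrite kq andbT.
apply: gle_gadd_setD1 (kA); apply: sl; [exact: valP | exact/eqP |].
by apply: gle_trans kA; apply/gleP => i; rewrite ffunE leq_addr.
Qed.

Lemma sub_exact_Zq_slack q j u i : slack q j u ->
  sub_exact (fun A => Zq q (morse_at Xf V u A)) i.
Proof.
by move=> sl; apply: (@sub_exact_contr _ _ _ j) => A jA; apply: capvS (Cq_slack sl jA) _.
Qed.

Lemma sub_exact_Bq_slack q j u i : slack q.+1 j u ->
  sub_exact (fun A => Bq q (morse_at Xf V u A)) i.
Proof.
by move=> sl; apply: (@sub_exact_contr _ _ _ j) => A jA; apply: limgS (Cq_slack sl jA).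
Qed.

(** Without slack, every coordinate of [u] is attained by a critical q-cell of grade below [u], so
    [u] is the join of all such grades; the list is nonempty because there is a direction. *)
Lemma join_or_slack q u : (0 < n)%N ->
  join_closure (morse_grades V Xf q) u \/ exists j, slack q j u.
Proof.
move=> n0; pose P := [pred c : X | [&& critical V c, cdim c == q & gle (h c) u]].
have [/existsP[j /forallP jP]|/existsPn none] :=
    boolP [exists j : 'I_n, [forall c, P c ==> (h c j < u j)%N]].
  by right; exists j => c cc /eqP cq cu; have := jP c; rewrite /= cc cq cu.
left; exists [seq h c | c <- enum P].
have top j : exists2 c, P c & (u j <= h c j)%N.
  by have /forallPn[c] := none j; rewrite negb_imply -leqNgt => /andP[]; exists c.
split=> [|v /mapP[c]|].
- have [c cP _] := top (Ordinal n0); rewrite -size_eq0 size_map -lt0n.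
  by rewrite -cardE; apply/card_gt0P; exists c.
- rewrite mem_enum => /and3P[cc /eqP cq cu] ->; exists c; split=> //.
  exact: entrance_gradeE.
apply/ffunP => i; rewrite ffunE; apply/eqP; rewrite eqn_leq; apply/andP; split.
  have [c cP uc] := top i; apply: leq_trans uc _.
  by rewrite big_map; apply: (leq_bigmax_seq (F := fun c => h c i)); rewrite ?mem_enum.
apply/bigmax_leqP_seq => v /mapP[c]; rewrite mem_enum => /and3P[_ _ /gleP cu] -> _.
exact: cu.
Qed.

Lemma morse_gradesP q u :
  morse_grades V Xf q u \/ forall c, critical V c -> cdim c = q -> h c != u.
Proof.
have [/existsP[c /and3P[cc /eqP cq /eqP <-]]|/existsPn none] :=
    boolP [exists c, [&& critical V c, cdim c == q & h c == u]].
  by left; exists c; split=> //; apply: entrance_gradeE.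
by right=> c cc cq; have := none c; rewrite cc cq eqxx.
Qed.

(** A cell of grade below [u] but different from [u] is strictly below in some coordinate j, hence
    lies in M^(u - e_j). *)
Lemma Bq_entrance q u : (forall c, critical V c -> cdim c = q.+1 -> h c != u) ->
  Bq q (morse_fam V Xf u) = (\sum_(j < n) Bsub V Xf q u (gunit j))%VS.
Proof.
move=> uN; have eu : morse_fam V Xf u = [set c | gle (h (val c)) u].
  by apply/setP => c; rewrite !inE hX inE.
apply/eqP; rewrite eqEsubv; apply/andP; split; last first.
  apply/subv_sumP => j _; apply: BqS; apply/subsetP => c.
  rewrite at_sub_morse eu !inE => ca; apply: gle_trans ca.
  by apply/gleP => i; rewrite ffunE leq_addr.
rewrite /Bsub /Bq -limg_sum; apply: limgS; apply/span_subvP => _ /mapP[c + ->].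
rewrite mem_filter mem_enum eu inE => /andP[/eqP cq /gleP cu].
have [j cj] : exists j, (h (val c) j < u j)%N.
  apply/existsP; apply: contraR (uN _ (valP c) cq) => /existsPn none.
  apply/eqP/ffunP => i; apply/eqP; rewrite eqn_leq cu /=.
  by rewrite leqNgt none.
apply: (subvP (sumv_sup j _ (subvv _))) => //.
apply/memv_span/map_f; rewrite mem_filter mem_enum cq eqxx at_sub_morse inE.
apply/gleP => i; rewrite !ffunE; case: eqP => [->|_]; first by rewrite addn1.
by rewrite addn0.
Qed.

Lemma sub_exact_Bq0 q u :
  Bq q (morse_fam V Xf u) = (\sum_(j < n) Bsub V Xf q u (gunit j))%VS ->
  sub_exact (fun A => Bq q (morse_at Xf V u A)) 0.
Proof.
move=> eB; apply: sub_exact0; rewrite morse_at0 eB.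
by apply/subv_sumP => j _; rewrite (sumv_sup j) // morse_at1.
Qed.

Lemma Zq0 (S : {set morse V}) : Zq 0 S = Cq 0 S.
Proof.
apply/eqP; rewrite eqEsubv capvSl; apply/subvP => c cS.
rewrite memv_cap cS memv_ker; apply/eqP/ffunP => s; rewrite boundaryE ffunE big1 // => t _.
have [->|/((elimT (mem_Cq _ _ _) cS) t)/andP[_ /eqP t0]] := eqVneq (c t) 0.
  by rewrite mul0r.
by rewrite /= /kappa_morse [cdim (val t)]t0 mulr0.
Qed.

Lemma sub_exact_Zq0 u i : sub_exact (fun A => Zq 0 (morse_at Xf V u A)) i.+1.
Proof.
apply: (@eq_sub_exact _ _ _ (fun A => Cq 0 (morse_at Xf V u A))) => [A|].
  by rewrite Zq0.
apply: (@sub_exact_Cq _ (morse V) n (fun c => h (val c)) u) => A.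
exact: at_sub_morse.
Qed.

Lemma morse_at2 u k l : k != l ->
  at_sub (morse_fam V Xf) u (gadd (gunit k) (gunit l)) = morse_at Xf V u [set k; l].
Proof.
move=> kl; congr (at_sub _ u _); apply/ffunP => i; rewrite !ffunE !inE.
by case: eqP => [->|_]; rewrite ?(negPf kl).
Qed.

Lemma Zq_morse_at2 q u k l :
  (Zq q (morse_at Xf V u [set k; l]) <= Zq q (morse_at Xf V u [set k]))%VS.
Proof.
apply: ZqS; apply/subsetP => c; rewrite /morse_at !at_sub_morse !inE.
apply: gle_trans; apply/gleP => i; rewrite !ffunE !inE leq_add2l.
by case: (i == k).
Qed.

(** Being a cycle does not depend on the grade, and a cell below both u - e_k and u - e_l is below
    their meet. *)
Lemma Zq_morse_at_cap q u k l :
  (Zq q (morse_at Xf V u [set k]) :&: Zq q (morse_at Xf V u [set l]) <=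
   Zq q (morse_at Xf V u [set k; l]))%VS.
Proof.
apply/subvP => c; rewrite !memv_cap => /andP[/andP[/mem_Cq ck ->] /andP[/mem_Cq cl _]].
rewrite andbT; apply/mem_Cq => s s0; have := ck s s0; have := cl s s0.
rewrite /morse_at !at_sub_morse !inE => /andP[/gleP sl ->] /andP[/gleP sk _].
rewrite andbT; apply/gleP => i; have := sl i; have := sk i; rewrite !ffunE !inE.
by case: (i == k).
Qed.

Lemma sub_exact_Zq_perm q u (rho : 'S_n) :
  (forall l : 'I_n,
    (Zsub V Xf q u (gunit (rho l)) :&:
     \sum_(j < n | (j < l)%N) Zsub V Xf q u (gunit (rho j)))%VS =
    (\sum_(j < n | (j < l)%N)
       Zsub V Xf q u (gadd (gunit (rho j)) (gunit (rho l))))%VS) ->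
  sub_exact (fun A => Zq q (morse_at Xf V u A)) 1.
Proof.
move=> hrho; apply: (@sub_exact1 _ _ _ _ rho) => [k l|l]; first exact: Zq_morse_at2.
rewrite morse_at1; under eq_bigr do rewrite morse_at1.
rewrite [X in (X <= _)%VS]hrho; apply/subv_sumP => j jl; rewrite (sumv_sup j) //.
rewrite /Zsub morse_at2 //; apply: contraTneq jl => /perm_inj ->.
by rewrite ltnn.
Qed.

(** With two directions each sum has at most one term, and the condition for the identity
    permutation is [Zq_morse_at_cap]. *)
Lemma sub_exact_Zq_dim2 q u : n = 2%N -> sub_exact (fun A => Zq q (morse_at Xf V u A)) 1.
Proof.
move=> n2; apply: (@sub_exact1 _ _ _ _ 1%g) => [k l|l]; first exact: Zq_morse_at2.
case: (pickP (fun j : 'I_n => (j < l)%N)) => [j jl|none]; last first.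
  by rewrite !big_pred0 // capv0 sub0v.
have l1 : (l <= 1)%N by rewrite -ltnS -[X in (_ < X)%N]n2 ltn_ord.
have lt0 (k : 'I_n) : (k < l)%N -> k = 0%N :> nat.
  by move=> kl; have := leq_trans kl l1; rewrite ltnS leqn0 => /eqP.
have eqj (i : 'I_n) : (i < l)%N = (i == j).
  by apply/idP/eqP => [il|-> //]; apply/val_inj; apply: etrans (lt0 _ il) (esym (lt0 _ jl)).
rewrite !(big_pred1 j) // !perm1 capvC; exact: Zq_morse_at_cap.
Qed.

End OneCritical.

Theorem corollary5p24 (F : fieldType) (n : nat) (hn : (0 < n)%N)
  (X : cellComplex F) (Xf : filtration n X)
  (hone : one_critical Xf) (hexh : exhaustive Xf)
  (V : {set X * X}) (hV : discrete_gradient_vector_field V)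
  (hcons : consistent V Xf) :
  (* (1) *)
  (forall q : nat,
    (forall u : grade n,
      Bq q (morse_fam V Xf u) = (\sum_(j < n) Bsub V Xf q u (gunit j))%VS ->
      (exists rho : 'S_n, forall l : 'I_n,
        (Zsub V Xf q u (gunit (rho l)) :&:
         \sum_(j < n | (j < l)%N) Zsub V Xf q u (gunit (rho j)))%VS =
        (\sum_(j < n | (j < l)%N)
           Zsub V Xf q u (gadd (gunit (rho j)) (gunit (rho l))))%VS) ->
      xi Xf q 1 u = 0%N) /\
    (forall u : grade n, supp_xi Xf q 1 u ->
      morse_grades V Xf q.+1 u \/ join_closure (morse_grades V Xf q) u)) /\
  (* (2) *)
  ((forall u : grade n,
      Bq 0 (morse_fam V Xf u) = (\sum_(j < n) Bsub V Xf 0 u (gunit j))%VS ->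
      xi Xf 0 1 u = 0%N) /\
   (forall u : grade n, supp_xi Xf 0 0 u ->
      join_closure (morse_grades V Xf 0) u) /\
   (forall u : grade n, supp_xi Xf 0 1 u -> morse_grades V Xf 1 u) /\
   (forall u : grade n,
      (exists i : nat, (1 <= i <= n)%N /\ supp_xi Xf 0 i u) ->
      join_closure (morse_grades V Xf 1) u)) /\
  (* (3) *)
  (n = 2%N -> forall q : nat,
    (forall u : grade n,
      Bq q (morse_fam V Xf u) = (\sum_(j < n) Bsub V Xf q u (gunit j))%VS ->
      xi Xf q 1 u = 0%N) /\
    (forall u : grade n, supp_xi Xf q 0 u ->
      join_closure (morse_grades V Xf q) u) /\
    (forall u : grade n, supp_xi Xf q 1 u -> morse_grades V Xf q.+1 u) /\
    (forall u : grade n, supp_xi Xf q 2 u ->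
      join_closure (morse_grades V Xf q.+1) u)).
Proof.
have [h [_ hX]] := hone.
(* Off the joins, a slack direction contracts the Koszul complex of the cycles. *)
have xi0 q u : supp_xi Xf q 0 u -> join_closure (morse_grades V Xf q) u.
  have [//|[j sl]] := join_or_slack V hX q u hn; case.
  apply: (xi_eq0 hV hcons); apply: pair_exact0.
  exact: (sub_exact_Zq_slack hX sl).
have xi1_perm q u : Bq q (morse_fam V Xf u) = (\sum_(j < n) Bsub V Xf q u (gunit j))%VS ->
    sub_exact (fun A => Zq q (morse_at Xf V u A)) 1 -> xi Xf q 1 u = 0%N.
  by move=> eB exZ; apply: (xiS_eq0 hV hcons exZ); apply: sub_exact_Bq0.
have xi1_grade q u : sub_exact (fun A => Zq q (morse_at Xf V u A)) 1 ->
    supp_xi Xf q 1 u -> morse_grades V Xf q.+1 u.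
  move=> exZ; have [//|uN] := morse_gradesP V hX q.+1 u; case.
  by apply: xi1_perm exZ; apply: (Bq_entrance hX).
(* Off the joins of grades of (q+1)-cells, a slack direction contracts the boundaries. *)
have xi_join q u i : sub_exact (fun A => Zq q (morse_at Xf V u A)) i.+1 ->
    supp_xi Xf q i.+1 u -> join_closure (morse_grades V Xf q.+1) u.
  move=> exZ; have [//|[j sl]] := join_or_slack V hX q.+1 u hn; case.
  by apply: (xiS_eq0 hV hcons exZ); apply: (sub_exact_Bq_slack hX sl).
split; [move=> q; split=> u | split; [split; [|split; [|split]]|]].
- by move=> eB [rho hrho]; apply: xi1_perm eB (sub_exact_Zq_perm hX hrho).
(* If [u] is not a join of grades of q-cells, slack makes the cycles exact, which leaves only the
   grades of (q+1)-cells. *)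
- move=> su; have [|[j sl]] := join_or_slack V hX q u hn; first by right.
  by left; apply: xi1_grade su; apply: (sub_exact_Zq_slack hX sl).
- by move=> u eB; apply: (xi1_perm _ _ eB); apply: (sub_exact_Zq0 hX).
- exact: xi0.
- by move=> u; apply/xi1_grade/(sub_exact_Zq0 hX).
- move=> u [[|i] [// _]]; apply: xi_join; exact: (sub_exact_Zq0 hX).
move=> n2 q; split; [|split; [|split]] => u.
- by move=> eB; apply: (xi1_perm _ _ eB); apply: (sub_exact_Zq_dim2 hX).
- exact: xi0.
- by apply: xi1_grade; apply: (sub_exact_Zq_dim2 hX).
by apply: xi_join; apply: sub_exact_top; rewrite ?n2.
Qed.
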